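(* Let $f_1,\dots,f_n$ be monotone linear functions (i.e. $\alpha(f_i)>0$ for all $i$). Then: (i) $f_1,\dots,f_n$ are colinear if and only if every permutation $\sigma:[n]\to[n]$ is minimum. (ii) If $f_1,\dots,f_n$ are not colinear, then the following are equivalent: (ii-1) $f_1,\dots,f_n$ are potentially identical; (ii-2) a permutation is minimum if and only if it is counterclockwise. (iii) If $f_1,\dots,f_n$ are neither colinear nor potentially identical, then a permutation $\sigma$ is minimum if and only if $\sigma$ is counterclockwise and $\theta(f^\sigma)+\pi\in[\theta(f_{\sigma(t)}),\theta(f_{\sigma(s)})]_{2\pi}$, where $s$ and $t$ are respectively the smallest and the largest index $i\in[n]$ such that $f_{\sigma(i)}$ is non-identical.
   Context: A linear function is $f:\mathbb{R}\to\mathbb{R}$, $f(x)=ax+b$ with $a,b\in\mathbb{R}$; write $\alpha(f)=a$, $\beta(f)=b$. $f$ is monotone (increasing) if $a>0$, constant if $a=0$, monotone decreasing if $a<0$, nondecreasing if $a\ge 0$, and identical if $f(x)=x$. The vector of $f$ is $\vec f=(b,\,1-a)^\top\in\mathbb{R}^2$; the angle $\theta(f)\in[0,2\pi)$ is the polar angle of $\vec f$, with $\theta(f)=\bot$ if $\vec f=0$ (i.e. $f$ is identical). For $\theta_1,\theta_2\in\mathbb{R}$ write $\theta_1=_{2\pi}\theta_2$ if $\theta_1-\theta_2\in2\pi\mathbb{Z}$, and $[\theta_1,\theta_2]_{2\pi}=\{\theta\in[\lambda_1,\lambda_2]\mid \lambda_1=_{2\pi}\theta_1,\ \lambda_2=_{2\pi}\theta_2,\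 \lambda_2-\lambda_1\in[0,2\pi)\}$ (open and half-open versions analogously); membership of an angle (possibly outside $[0,2\pi)$) in such a set is thus taken modulo $2\pi$. For functions, $g\le h$ (resp. $g<h$) means $g(x)\le h(x)$ (resp. $<$) for all $x$. For linear functions $f_1,\dots,f_n$ and a permutation $\sigma$ of $[n]=\{1,\dots,n\}$, $f^\sigma=f_{\sigma(n)}\circ\cdots\circ f_{\sigma(1)}$. $\sigma$ is minimum (optimal) if $f^\sigma\le f^\rho$ for every permutation $\rho$, and maximum if $f^\sigma\ge f^\rho$ for every $\rho$. $\sigma$ is counterclockwise if, after discarding the positions $i$ with $f_{\sigma(i)}$ identical, there is $k$ such that $\theta(f_{\sigma(k)})\le\cdots\le\theta(f_{\sigma(n)})\le\theta(f_{\sigma(1)})\le\cdots\le\theta(f_{\sigma(k-1)})$ (i.e. the remaining sequence of angles becomes nondecreasing after a cyclic rotation). $f_1,\dots,f_n$ are colinear if there is $\lambda$ with $\theta(f_i)\in\{\lambda,\lambda+\pi\}_{2\pi}\cup\{\bot\}$ for all $i$, and potentially identical if some counterclockwise permutation $\sigma$ satisfies $f^\sigma(x)=x$. *)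

(* Defs.v *)
From HB Require Import structures.
From mathcomp Require Import all_boot all_order all_algebra.
From mathcomp Require Import all_classical all_reals.
From mathcomp Require Import trigo.
From mathcomp Require Import fingroup perm.
Set Implicit Arguments. Unset Strict Implicit. Unset Printing Implicit Defensive.
Import Order.TTheory GRing.Theory Num.Theory.
Local Open Scope ring_scope.

Definition affn (R : realType) := (R * R)%type.
Definition alpha {R : realType} (f : affn R) : R := f.1.
Definition beta {R : realType} (f : affn R) : R := f.2.
Definition app {R : realType} (f : affn R) (x : R) : R := alpha f * x + beta f.

Definition lcomp {R : realType} (g f : affn R) : affn R :=
  (alpha g * alpha f, alpha g * beta f + beta g).
Definition lid {R : realType} : affn R := (1, 0).

Definition identical {R : realType} (f : affn R) : Prop := forall x, app f x = x.

Definition fvec {R : realType} (f : affn R) : R * R := (beta f, 1 - alpha f).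

Definition theta {R : realType} (f : affn R) : option R :=
  let v := fvec f in
  if (v.1 == 0) && (v.2 == 0) then None
  else Some (xget 0 [set t : R | 0 <= t < 2 * pi /\
                    v.1 = Num.sqrt (v.1 ^+ 2 + v.2 ^+ 2) * cos t /\
                    v.2 = Num.sqrt (v.1 ^+ 2 + v.2 ^+ 2) * sin t]).

Definition eqmod2pi {R : realType} (t1 t2 : R) : Prop :=
  exists k : int, t1 - t2 = k%:~R * (2 * pi).

Definition in_arc {R : realType} (t t1 t2 : R) : Prop :=
  exists l1 l2 l : R, [/\ eqmod2pi l1 t1, eqmod2pi l2 t2, 0 <= l2 - l1 < 2 * pi,
                          eqmod2pi l t & l1 <= l <= l2].

Definition fsig {R : realType} {n : nat} (fs : 'I_n -> affn R) (s : 'S_n) : affn R :=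
  foldl (fun acc i => lcomp (fs (s i)) acc) lid (enum 'I_n).

Definition fle {R : realType} (g h : affn R) : Prop := forall x, app g x <= app h x.

Definition is_minimum {R : realType} {n : nat} (fs : 'I_n -> affn R) (s : 'S_n) : Prop :=
  forall r : 'S_n, fle (fsig fs s) (fsig fs r).

Definition angle_seq {R : realType} {n : nat} (fs : 'I_n -> affn R) (s : 'S_n) : seq R :=
  pmap (fun i => theta (fs (s i))) (enum 'I_n).

Definition counterclockwise {R : realType} {n : nat} (fs : 'I_n -> affn R) (s : 'S_n) : Prop :=
  exists k : nat, sorted <=%R (rot k (angle_seq fs s)).

Definition colinear {R : realType} {n : nat} (fs : 'I_n -> affn R) : Prop :=
  exists l : R, forall i, theta (fs i) = None \/
    exists t, theta (fs i) = Some t /\ (eqmod2pi t l \/ eqmod2pi t (l + pi)).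

Definition potentially_identical {R : realType} {n : nat} (fs : 'I_n -> affn R) : Prop :=
  exists s : 'S_n, counterclockwise fs s /\ identical (fsig fs s).

Definition arc_condition {R : realType} {n : nat} (fs : 'I_n -> affn R) (s : 'S_n) : Prop :=
  exists (i0 i1 : 'I_n) (a a0 a1 : R),
    [/\ theta (fsig fs s) = Some a, theta (fs (s i0)) = Some a0, theta (fs (s i1)) = Some a1,
        (forall j : 'I_n, theta (fs (s j)) <> None -> (i0 <= j <= i1)%N) &
        in_arc (a + pi) a1 a0].

(* Main.v *)
(* Writing v(f) for the vector of f, one has v(g o f) = alpha(g) v(f) + v(g), so a
   composition w draws a broken line from 0 to V = v(f^w) whose steps are positive
   multiples of the v(f_i); alpha(f^w) does not depend on the order, so only
   beta(f^w) has to be minimized.  Exchanging two adjacent blocks changes beta by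
   a positive multiple of the cross product of their vectors, hence for an
   optimal order any three vertices of the broken line turn counterclockwise.
   If V <> 0 this forces the broken line closed by its chord to be a convex
   polygon: the distance of the vertices to the chord is unimodal.  If V = 0 the
   same holds for the line without its first step.  Conversely two convex orders
   are, up to ties, rotations A B and B A of each other; convexity of the first
   gives beta(AB) <= beta(BA) and convexity of the second the reverse.  If the
   rotations of one order all have the same beta, then all prefixes, hence all
   steps, are parallel to V, which is the colinear case unless V = 0. *)
Require Import Defs.
From HB Require Import structures.
From mathcomp Require Import all_boot all_order all_algebra.
From mathcomp Require Import all_classical all_reals.
From mathcomp Require Import trigo.
From mathcomp Require Import fingroup perm.
From mathcomp Require Import ring lra.
Set Implicit Arguments. Unset Strict Implicit. Unset Printing Implicit Defensive.
Import Order.TTheory GRing.Theory Num.Theory.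
Local Open Scope ring_scope.

(** * Signs of the sine and uniqueness of polar angles *)

Lemma sin_le0_pi (R : realType) (x : R) : pi <= x <= 2 * pi -> sin x <= 0.
Proof.
move=> /andP[h1 h2]; have := @sin_ge0_pi R (x - pi).
by rewrite sinB sinpi cospi; lra.
Qed.

Lemma sin_lt0_pi (R : realType) (x : R) : pi < x < 2 * pi -> sin x < 0.
Proof.
move=> /andP[h1 h2]; have := @sin_gt0_pi R (x - pi).
by rewrite sinB sinpi cospi; lra.
Qed.

Lemma sin_eq0_pi (R : realType) (x : R) :
  0 <= x < 2 * pi -> sin x = 0 -> x = 0 \/ x = pi.
Proof.
move=> hx hs; have pi0 := @pi_gt0 R.
have [x0|x0] := eqVneq x 0; first by left.
have [xp|xp] := eqVneq x pi; first by right.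
have [h|h] := ltP x pi.
  by have := @sin_gt0_pi R x; rewrite hs; move: x0; rewrite neq_lt; lra.
by have := @sin_lt0_pi R x; rewrite hs; move: xp; rewrite neq_lt; lra.
Qed.

Lemma polar_unique (R : realType) (t u : R) :
  0 <= t < 2 * pi -> 0 <= u < 2 * pi -> cos t = cos u -> sin t = sin u -> t = u.
Proof.
wlog: t u / u <= t.
  move=> hw ht hu hc hs; have [h|h] := leP u t; first exact: hw.
  by symmetry; apply: hw => //; exact: ltW.
move=> ut ht hu hc hs; have pi0 := @pi_gt0 R.
have : sin (t - u) = 0 by rewrite sinB hc hs; ring.
case/sin_eq0_pi => [||e]; [by lra|by lra|].
have : cos (t - u) = 1 by rewrite cosB hc hs -!expr2 cos2Dsin2.
by rewrite e cospi => ?; lra.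
Qed.

(** Adding the squares of the two equations gives [a = b], and then the radius cancels. *)
Lemma polar_unique_scaled (R : realType) (a b t u : R) :
  0 < a -> 0 < b -> 0 <= t < 2 * pi -> 0 <= u < 2 * pi ->
  a * cos t = b * cos u -> a * sin t = b * sin u -> t = u.
Proof.
move=> a0 b0 ht hu hc hs.
have ab : a = b.
  apply/eqP; rewrite -(@eqrXn2 _ 2) ?ltW //; apply/eqP.
  rewrite -[LHS]mulr1 -[RHS]mulr1 -{1}(cos2Dsin2 t) -(cos2Dsin2 u) !mulrDr.
  by rewrite -!exprMn hc hs.
rewrite -ab in hc hs; apply: polar_unique => //.
  exact: (mulfI (lt0r_neq0 a0)).
exact: (mulfI (lt0r_neq0 a0)).
Qed.

Lemma polar_exists (R : realType) (x y : R) : x ^+ 2 + y ^+ 2 = 1 ->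
  exists t, [/\ 0 <= t < 2 * pi, x = cos t & y = sin t].
Proof.
move=> hxy; have pi0 := @pi_gt0 R.
have hx : -1 <= x <= 1 by nra.
have hc : cos (acos x) = x by apply: acosK; rewrite in_itv.
have hs : sin (acos x) = `|y|.
  by rewrite sin_acos // -sqrtr_sqr; congr Num.sqrt; lra.
have h0 := acos_ge0 hx; have hp := acos_lepi hx.
have [y0|y0] := leP 0 y.
  by exists (acos x); rewrite hc hs ger0_norm //; split => //; lra.
have a0 : acos x != 0.
  by apply/eqP => a0; move: hs; rewrite a0 sin0 ltr0_norm //; lra.
exists (2 * pi - acos x); split.
- by move: a0; rewrite neq_lt; lra.
- by rewrite cosB mulr_natl cos2pi sin2pi hc; ring.
- by rewrite sinB mulr_natl cos2pi sin2pi hs ltr0_norm //; ring.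
Qed.

(** * Congruence of angles modulo 2 pi *)

Lemma eqmod2pi_refl (R : realType) (t : R) : eqmod2pi t t.
Proof. by exists 0; rewrite subrr mul0r. Qed.

Lemma eqmod2pi_sym (R : realType) (t u : R) : eqmod2pi t u -> eqmod2pi u t.
Proof. by case=> k e; exists (- k); rewrite mulrNz mulNr -e opprB. Qed.

Lemma eqmod2pi_trans (R : realType) (t u v : R) :
  eqmod2pi t u -> eqmod2pi u v -> eqmod2pi t v.
Proof.
by case=> k e [m e']; exists (k + m); rewrite intrD mulrDl -e -e'; ring.
Qed.

Lemma eqmod2pi_add (R : realType) (t u t' u' : R) :
  eqmod2pi t u -> eqmod2pi t' u' -> eqmod2pi (t + t') (u + u').
Proof.
by case=> k e [m e']; exists (k + m); rewrite intrD mulrDl -e -e'; ring.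
Qed.

Lemma eqmod2piD2pi (R : realType) (t : R) : eqmod2pi (t + 2 * pi) t.
Proof. by exists 1; ring. Qed.

Lemma cos_sin_eqmod2pi (R : realType) (t u : R) :
  eqmod2pi t u -> cos t = cos u /\ sin t = sin u.
Proof.
have nat_shift (k : nat) (v : R) :
    cos (v + k%:R * (2 * pi)) = cos v /\ sin (v + k%:R * (2 * pi)) = sin v.
  elim: k => [|k [ihc ihs]]; first by rewrite mul0r addr0.
  have -> : v + k.+1%:R * (2 * pi) = v + k%:R * (2 * pi) + pi *+ 2 :> R.
    by rewrite -natr1 -[pi *+ 2]mulr_natl; ring.
  by rewrite cosD2pi sinD2pi.
case=> -[k|k] e.
  have -> : t = u + k%:R * (2 * pi) by rewrite -[k%:R]/((Posz k)%:~R) -e; ring.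
  exact: nat_shift.
have -> : u = t + k.+1%:R * (2 * pi).
  by move: e; rewrite NegzE mulrNz -pmulrn mulNr => e; lra.
by have [-> ->] := nat_shift k.+1 t.
Qed.

Lemma eqmod2pi_eq (R : realType) (t u : R) :
  `|t - u| < 2 * pi -> eqmod2pi t u -> t = u.
Proof.
move=> h [k e]; have pi0 := @pi_gt0 R.
move: h; rewrite e normrM [`|2 * pi|]gtr0_norm; last by lra.
rewrite gtr_pMl; last by lra.
rewrite -intr_norm -[1]/(1%:~R) ltr_int => hk.
have k0 : k = 0 by apply/eqP; rewrite -normr_le0 -ltzD1.
by move: e; rewrite k0 mul0r => /subr0_eq.
Qed.

Lemma eqmod2pi_repr (R : realType) (t : R) :
  exists2 u, 0 <= u < 2 * pi & eqmod2pi u t.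
Proof.
have pi0 := @pi_gt0 R; have p2 : 0 < 2 * pi :> R by lra.
exists (t - (Num.floor (t / (2 * pi)))%:~R * (2 * pi)).
  have := Num.Theory.floor_itv (t / (2 * pi)).
  by rewrite ler_pdivlMr // ltr_pdivrMr // intrD mulrDl mul1r; lra.
by exists (- Num.floor (t / (2 * pi))); rewrite mulrNz; ring.
Qed.

(** * Compositions of words, cross products and optimal orders *)

(* The cross product of [fvec f] and [fvec g]. *)
Definition cross {R : realType} (f g : affn R) : R :=
  beta f * (1 - alpha g) - (1 - alpha f) * beta g.

(** The head of the word is applied first, as in [fsig]. *)
Definition wcomp {R : realType} (w : seq (affn R)) : affn R :=
  foldl (fun acc f => lcomp f acc) lid w.

Definition wincr {R : realType} (w : seq (affn R)) : Prop :=
  {in w, forall f, 0 < alpha f}.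

Definition colin {R : realType} (w : seq (affn R)) : Prop :=
  {in w &, forall f g, cross f g = 0}.

Definition optimal {R : realType} (w : seq (affn R)) : Prop :=
  forall v, perm_eq v w -> beta (wcomp w) <= beta (wcomp v).

Lemma crossff (R : realType) (f : affn R) : cross f f = 0.
Proof. by rewrite /cross; ring. Qed.

Lemma crossC (R : realType) (f g : affn R) : cross f g = - cross g f.
Proof. by rewrite /cross; ring. Qed.

Lemma cross_lcompl (R : realType) (f g h : affn R) :
  cross (lcomp g f) h = alpha g * cross f h + cross g h.
Proof. by rewrite /cross /lcomp /alpha /beta /=; ring. Qed.

Lemma beta_lcompC (R : realType) (f g : affn R) :
  beta (lcomp f g) - beta (lcomp g f) = cross f g.
Proof. by rewrite /cross /lcomp /alpha /beta /=; ring. Qed.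

Lemma lcompA (R : realType) (f g h : affn R) :
  lcomp f (lcomp g h) = lcomp (lcomp f g) h.
Proof. by rewrite /lcomp /alpha /beta /=; congr pair; ring. Qed.

Lemma lcompidl (R : realType) (f : affn R) : lcomp lid f = f.
Proof. by case: f => a b; rewrite /lcomp /lid /alpha /beta /= !mul1r addr0. Qed.

Lemma lcompidr (R : realType) (f : affn R) : lcomp f lid = f.
Proof. by case: f => a b; rewrite /lcomp /lid /alpha /beta /= mulr1 mulr0 add0r. Qed.

Lemma lcomp_commute (R : realType) (f g : affn R) :
  cross f g = 0 -> lcomp f g = lcomp g f.
Proof.
rewrite -beta_lcompC /lcomp /alpha /beta /= => /eqP; rewrite subr_eq0 => /eqP e.
by rewrite e; congr pair; ring.
Qed.

Lemma wcomp_cat (R : realType) (v w : seq (affn R)) :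
  wcomp (v ++ w) = lcomp (wcomp w) (wcomp v).
Proof.
rewrite /wcomp foldl_cat; elim/last_ind: w => [|w f ih]; first by rewrite lcompidl.
by rewrite -cats1 !foldl_cat /= ih lcompA.
Qed.

Lemma wcomp_cons (R : realType) (f : affn R) (w : seq (affn R)) :
  wcomp (f :: w) = lcomp (wcomp w) f.
Proof. by rewrite -cat1s wcomp_cat /wcomp /= lcompidr. Qed.

Lemma alpha_lcomp (R : realType) (f g : affn R) :
  alpha (lcomp f g) = alpha f * alpha g.
Proof. by []. Qed.

Lemma wincr_cat (R : realType) (v w : seq (affn R)) :
  wincr (v ++ w) -> wincr v /\ wincr w.
Proof. by move=> h; split=> f fv; apply: h; rewrite mem_cat fv ?orbT. Qed.

Lemma wincr_perm (R : realType) (v w : seq (affn R)) :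
  perm_eq v w -> wincr w -> wincr v.
Proof. by move=> e h f; rewrite (perm_mem e); apply: h. Qed.

Lemma alpha_wcomp_gt0 (R : realType) (w : seq (affn R)) :
  wincr w -> 0 < alpha (wcomp w).
Proof.
elim: w => [_|f w ih h]; first by rewrite /wcomp /alpha /= ltr01.
rewrite wcomp_cons mulr_gt0 //; last by apply: h; rewrite mem_head.
by apply: ih => g gw; apply: h; rewrite inE gw orbT.
Qed.

Lemma alpha_wcomp_prod (R : realType) (w : seq (affn R)) :
  alpha (wcomp w) = \prod_(f <- w) alpha f.
Proof.
elim: w => [|f w ih]; first by rewrite big_nil.
by rewrite wcomp_cons big_cons alpha_lcomp ih mulrC.
Qed.

Lemma alpha_wcomp_perm (R : realType) (v w : seq (affn R)) :
  perm_eq v w -> alpha (wcomp v) = alpha (wcomp w).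
Proof. by move=> e; rewrite !alpha_wcomp_prod (perm_big _ e). Qed.

Lemma cross_wcomp_ge0 (R : realType) (w : seq (affn R)) (g : affn R) :
  wincr w -> {in w, forall f, 0 <= cross f g} -> 0 <= cross (wcomp w) g.
Proof.
elim: w => [_ _|f w ih hm h]; first by rewrite /cross /wcomp /= /alpha /beta /=; lra.
have hw : wincr w by move=> x xw; apply: hm; rewrite inE xw orbT.
rewrite wcomp_cons cross_lcompl addr_ge0 //.
  by rewrite mulr_ge0 ?(ltW (alpha_wcomp_gt0 hw)) // h // mem_head.
by apply: ih => // x xw; apply: h; rewrite inE xw orbT.
Qed.

Lemma cross_wcomp_le0 (R : realType) (w : seq (affn R)) (g : affn R) :
  wincr w -> {in w, forall f, cross f g <= 0} -> cross (wcomp w) g <= 0.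
Proof.
elim: w => [_ _|f w ih hm h]; first by rewrite /cross /wcomp /= /alpha /beta /=; lra.
have hw : wincr w by move=> x xw; apply: hm; rewrite inE xw orbT.
rewrite wcomp_cons cross_lcompl -oppr_ge0 opprD addr_ge0 // oppr_ge0.
  by rewrite mulr_ge0_le0 ?(ltW (alpha_wcomp_gt0 hw)) // h // mem_head.
by apply: ih => // x xw; apply: h; rewrite inE xw orbT.
Qed.

Lemma cross_wcomp_eq0 (R : realType) (w : seq (affn R)) (g : affn R) :
  wincr w -> {in w, forall f, cross f g = 0} -> cross (wcomp w) g = 0.
Proof.
move=> hm h; apply/eqP; rewrite eq_le.
by rewrite cross_wcomp_ge0 ?cross_wcomp_le0 // => f /h ->.
Qed.

(** The vector of [v ++ w] is a multiple of the vector of [v] plus the vector of [w], and the first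
    summand drops out. *)
Lemma cross_prefix_suffix (R : realType) (v w : seq (affn R)) :
  cross (wcomp v) (wcomp (v ++ w)) = cross (wcomp v) (wcomp w).
Proof. by rewrite wcomp_cat crossC cross_lcompl crossff mulr0 add0r -crossC. Qed.

Lemma cross_suffix_prefix (R : realType) (v w : seq (affn R)) :
  cross (wcomp w) (wcomp (v ++ w)) = - (alpha (wcomp w) * cross (wcomp v) (wcomp w)).
Proof. by rewrite wcomp_cat crossC cross_lcompl crossff addr0. Qed.

(** Exchanging the blocks [v] and [w] raises [beta] by [alpha (wcomp b)] times this cross
    product. *)
Lemma optimal_cross_ge0 (R : realType) (a v w b : seq (affn R)) :
  wincr b -> optimal (a ++ v ++ w ++ b) -> 0 <= cross (wcomp v) (wcomp w).
Proof.
move=> /alpha_wcomp_gt0 hb /(_ (a ++ w ++ v ++ b)).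
rewrite perm_cat2l !catA perm_cat2r perm_catC => /(_ (perm_refl _)).
rewrite -!catA !wcomp_cat /cross /lcomp /alpha /beta /= in hb *.
move=> h; rewrite -(pmulr_rge0 _ hb); lra.
Qed.

Lemma optimal_perm (R : realType) (v w : seq (affn R)) :
  perm_eq v w -> beta (wcomp v) = beta (wcomp w) -> optimal w -> optimal v.
Proof. by move=> e eb h u eu; rewrite eb h // (perm_trans eu). Qed.

(** Two sorted arrangements differ only among equal keys, and functions with equal keys commute. The
    induction moves the head of [v] to the front of [w], past a block [l] whose keys all equal its
    own. *)
Lemma wcomp_sorted_key (R : realType) (key : affn R -> R) (v w : seq (affn R)) :
  perm_eq v w -> pairwise (relpre key <=%R) v -> pairwise (relpre key <=%R) w ->
  wincr v -> {in v &, forall f g, key f = key g -> cross f g = 0} ->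
  wcomp v = wcomp w.
Proof.
elim: v w => [|f v ih] w e; first by move: e; rewrite perm_sym => /perm_nilP ->.
have fw : f \in w by rewrite -(perm_mem e) mem_head.
case/splitPr: fw e => l r e; rewrite pairwise_cons => /andP[hf hv].
rewrite pairwise_cat /= => /and3P[/allrelP hlr hl /andP[_ hr]] hm hc.
have e' : perm_eq v (l ++ r).
  by rewrite -(perm_cons f) (perm_trans e) // perm_catC /= perm_cons perm_catC.
have hlf : {in l, forall g, cross g f = 0}.
  move=> g gl; have gv : g \in v by rewrite (perm_mem e') mem_cat gl.
  apply: hc; rewrite ?mem_head ?inE ?gv ?orbT //.
  by apply/le_anti/andP; split; [apply: hlr; rewrite ?mem_head|apply: (allP hf)].
have hmv : wincr v by move=> x xv; apply: hm; rewrite inE xv orbT.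
rewrite wcomp_cons (ih (l ++ r)) //; last first.
- by move=> x y xv yv; apply: hc; rewrite inE ?xv ?yv orbT.
- rewrite pairwise_cat hl hr !andbT; apply/allrelP => x y xl yr.
  by apply: hlr; rewrite // inE yr orbT.
have hml : wincr l.
  by move=> x xl; apply: hmv; rewrite (perm_mem e') mem_cat xl.
rewrite !wcomp_cat wcomp_cons -!lcompA; congr lcomp.
by apply: lcomp_commute; apply: cross_wcomp_eq0.
Qed.

Lemma pairwise_key_eq (R : realType) (key : affn R -> R) (c : R) (w : seq (affn R)) :
  {in w, forall f, key f = c} -> pairwise (relpre key <=%R) w.
Proof.
elim: w => //= f w ih h; rewrite ih ?andbT => [|g gw]; last first.
  by apply: h; rewrite inE gw orbT.
by apply/allP => g gw /=; rewrite !h ?inE ?eqxx ?gw ?orbT.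
Qed.

Lemma colin_wcomp_perm (R : realType) (v w : seq (affn R)) :
  wincr v -> colin v -> perm_eq v w -> wcomp v = wcomp w.
Proof.
move=> hm hc e; apply: (wcomp_sorted_key (key := fun=> 0)) => //.
- exact: (pairwise_key_eq (c := 0)).
- exact: (pairwise_key_eq (c := 0)).
- by move=> x y xv yv _; apply: hc.
Qed.

(** Put [f] and [g] in front in either order: optimality of both words gives the cross product both
    signs. *)
Lemma optimal_all_colin (R : realType) (w : seq (affn R)) :
  wincr w -> (forall v, perm_eq v w -> optimal v) -> colin w.
Proof.
move=> hm h f g fw gw; have [->|fg] := eqVneq f g; first exact: crossff.
have gr : g \in rem f w.
  by move: gw; rewrite (perm_mem (perm_to_rem fw)) inE eq_sym (negPf fg).
set u := rem g (rem f w).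
have e1 : perm_eq w ([:: f] ++ [:: g] ++ u).
  by rewrite (perm_trans (perm_to_rem fw)) //= perm_cons perm_to_rem.
have e2 : perm_eq w ([:: g] ++ [:: f] ++ u).
  by rewrite (perm_trans e1) // perm_catCA.
have hu : wincr u by move=> x xu; apply: hm; rewrite (perm_mem e1) !mem_cat xu !orbT.
have := @optimal_cross_ge0 R [::] [:: f] [:: g] u hu.
have := @optimal_cross_ge0 R [::] [:: g] [:: f] u hu.
rewrite /= /wcomp /= !lcompidr => /(_ (h _ _)) h1 /(_ (h _ _)) h2.
apply/eqP; rewrite eq_le h2 1?perm_sym // andbT crossC oppr_le0.
by apply: h1; rewrite perm_sym.
Qed.

(** * Polar form of the vectors, antipodes and arcs *)

Definition ang {R : realType} (f : affn R) : R := odflt 0 (theta f).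

Definition radius {R : realType} (f : affn R) : R :=
  Num.sqrt (beta f ^+ 2 + (1 - alpha f) ^+ 2).

Lemma fvec_eq0 (R : realType) (f : affn R) :
  (beta f == 0) && (1 - alpha f == 0) = (f == lid).
Proof.
case: f => a b; rewrite /lid xpair_eqE /alpha /beta /= andbC; congr (_ && _).
by rewrite subr_eq0 eq_sym.
Qed.

Lemma theta_lid (R : realType) : theta (lid : affn R) = None.
Proof. by rewrite /theta /fvec fvec_eq0 eqxx. Qed.

Lemma theta_Some (R : realType) (f : affn R) : f != lid -> theta f = Some (ang f).
Proof. by rewrite /ang /theta /fvec fvec_eq0 => /negPf ->. Qed.

Lemma radius_gt0 (R : realType) (f : affn R) : f != lid -> 0 < radius f.
Proof.
rewrite -fvec_eq0 => h; rewrite sqrtr_gt0 lt_def addr_ge0 ?sqr_ge0 // andbT.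
by rewrite paddr_eq0 ?sqr_ge0 // !sqrf_eq0.
Qed.

(** The normalised vector lies on the unit circle, so the set inside [theta] is inhabited and [xget]
    returns a genuine polar angle, not its default. *)
Lemma ang_polar (R : realType) (f : affn R) : f != lid ->
  [/\ 0 <= ang f < 2 * pi, beta f = radius f * cos (ang f)
    & 1 - alpha f = radius f * sin (ang f)].
Proof.
move=> hf; have r0 := radius_gt0 hf; have rN0 : radius f != 0 by rewrite gt_eqF.
have e : radius f ^+ 2 = beta f ^+ 2 + (1 - alpha f) ^+ 2.
  by rewrite sqr_sqrtr // addr_ge0 ?sqr_ge0.
have [t [ht hc hs]] : exists t, [/\ 0 <= t < 2 * pi,
    beta f / radius f = cos t & (1 - alpha f) / radius f = sin t].
  by apply: polar_exists; rewrite !expr_div_n -mulrDl -e divff // expf_neq0.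
rewrite /ang /theta /fvec fvec_eq0 (negPf hf) /= -/(radius f).
set S := (X in xget 0 X).
have : S (xget 0 S).
  apply: xgetPex; exists t.
  by split=> //; split; rewrite /= -/(radius f) -?hc -?hs mulrC divfK.
by case=> h1 [h2 h3].
Qed.

Lemma cross_ang (R : realType) (f g : affn R) : f != lid -> g != lid ->
  cross f g = radius f * radius g * sin (ang g - ang f).
Proof.
move=> /ang_polar[_ h1 h2] /ang_polar[_ h3 h4].
by rewrite /cross h1 h2 h3 h4 sinB; ring.
Qed.

(* [c] is the polar angle of the opposite of [fvec f]. *)
Definition antipode {R : realType} (f : affn R) (c : R) : Prop :=
  [/\ f != lid, 0 <= c < 2 * pi & eqmod2pi c (ang f + pi)].

Lemma antipode_exists (R : realType) (f : affn R) :
  f != lid -> exists c, antipode f c.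
Proof. by move=> hf; have [c hc e] := eqmod2pi_repr (ang f + pi); exists c. Qed.

Lemma antipode_polar (R : realType) (f : affn R) (c : R) : antipode f c ->
  beta f = - (radius f * cos c) /\ 1 - alpha f = - (radius f * sin c).
Proof.
case=> /ang_polar[_ -> ->] _ /cos_sin_eqmod2pi[-> ->].
by rewrite cosDpi sinDpi !mulrN !opprK.
Qed.

Lemma cross_antipode (R : realType) (f g : affn R) (c : R) :
  f != lid -> antipode g c -> cross f g = radius f * radius g * sin (ang f - c).
Proof.
move=> /ang_polar[_ h1 h2] /antipode_polar[h3 h4].
by rewrite /cross h1 h2 h3 h4 sinB; ring.
Qed.

(** Turns arc membership modulo 2 pi into comparisons in [[0, 2 pi)]; for [u < t] the arc wraps
    through 0. *)
Lemma in_arcP (R : realType) (a c t u : R) :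
  0 <= c < 2 * pi -> 0 <= t < 2 * pi -> 0 <= u < 2 * pi -> eqmod2pi c a ->
  in_arc a t u <-> if t <= u then t <= c <= u else (t <= c) || (c <= u).
Proof.
move=> hc ht hu ca; have pi0 := @pi_gt0 R; split.
  case=> l1 [l2 [l [e1 e2 hl el hl2]]].
  have elc : eqmod2pi l c by apply: eqmod2pi_trans el (eqmod2pi_sym ca).
  (* Shift the arc so that it starts at [t]: in the window [[t, t + 2 pi)] each residue has just one
     representative, given by [rep]. *)
  pose l2' := l2 + (t - l1); pose l' := l + (t - l1).
  have e0 : eqmod2pi (t - l1) 0.
    by case: (eqmod2pi_sym e1) => k ek; exists k; rewrite subr0.
  have e2' : eqmod2pi l2' u by rewrite -[u]addr0; apply: eqmod2pi_add.
  have el' : eqmod2pi l' c by rewrite -[c]addr0; apply: eqmod2pi_add.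
  have h1 : t <= l' <= l2' by rewrite /l' /l2'; lra.
  have h2 : l2' < t + 2 * pi by rewrite /l2'; lra.
  have rep x y : eqmod2pi x y -> t <= x < t + 2 * pi -> 0 <= y < 2 * pi ->
      x = if t <= y then y else y + 2 * pi.
    move=> exy hx hy; case: leP => hty; apply: eqmod2pi_eq.
    - by rewrite ltr_norml; lra.
    - by [].
    - by rewrite ltr_norml; lra.
    - exact: eqmod2pi_trans exy (eqmod2pi_sym (eqmod2piD2pi _)).
  have eqc : l' = if t <= c then c else c + 2 * pi by apply: rep => //; lra.
  have equ : l2' = if t <= u then u else u + 2 * pi by apply: rep => //; lra.
  move: h1; rewrite eqc equ.
  by case: (leP t u) => tu; case: (leP t c) => tc //=; lra.
case: (leP t u) => tu h.
  by exists t, u, c; split=> //; [exact: eqmod2pi_refl|exact: eqmod2pi_refl|lra].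
have [tc|tc] := leP t c.
  exists t, (u + 2 * pi), c; split=> //; [exact: eqmod2pi_refl|exact: eqmod2piD2pi|lra|lra].
exists t, (u + 2 * pi), (c + 2 * pi); split.
- exact: eqmod2pi_refl.
- exact: eqmod2piD2pi.
- by lra.
- exact: eqmod2pi_trans (eqmod2piD2pi _) ca.
- by move: h; rewrite leNgt tc /=; lra.
Qed.

(** * Convex orders and their common composition *)

Definition ordered {R : realType} (w : seq (affn R)) : bool :=
  pairwise (relpre ang <=%R) w.

(* The broken line with steps [w], closed by a chord of direction [c], is a convex
   polygon: its angles are nondecreasing in [[c, c + 2 pi]], where those of [v]
   have been lifted by [2 pi]. *)
Definition convex_at {R : realType} (c : R) (w : seq (affn R)) : Prop :=
  exists u v, [/\ w = u ++ v, ordered u, ordered v,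
    {in u, forall f, c <= ang f} & {in v, forall f, ang f <= c}].

(** The representative of the angle in the window [[c, c + 2 pi)]. *)
Definition ang_from {R : realType} (c : R) (f : affn R) : R :=
  if c <= ang f then ang f else ang f + 2 * pi.

Lemma cross_ang_eq (R : realType) (f g : affn R) :
  f != lid -> g != lid -> ang f = ang g -> cross f g = 0.
Proof. by move=> f0 g0 e; rewrite cross_ang // e subrr sin0 mulr0. Qed.

Lemma lid_notin_neq (R : realType) (w : seq (affn R)) (f : affn R) :
  lid \notin w -> f \in w -> f != lid.
Proof. by move=> h fw; apply: contraNneq h => <-. Qed.

Lemma wcomp_ordered (R : realType) (v w : seq (affn R)) :
  wincr v -> lid \notin v -> perm_eq v w -> ordered v -> ordered w ->
  wcomp v = wcomp w.
Proof.
move=> hm hl e hv hw; apply: (wcomp_sorted_key (key := ang)) => // f g fv gv.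
by apply: cross_ang_eq; apply: (lid_notin_neq hl).
Qed.

Lemma ang_from_itv (R : realType) (c : R) (f : affn R) :
  0 <= c < 2 * pi -> f != lid -> c <= ang_from c f < c + 2 * pi.
Proof.
move=> hc /ang_polar[hf _ _]; have pi0 := @pi_gt0 R.
by rewrite /ang_from; case: (leP c (ang f)) => h; lra.
Qed.

Lemma ang_from_inj (R : realType) (c : R) (f g : affn R) :
  f != lid -> g != lid -> ang_from c f = ang_from c g -> ang f = ang g.
Proof.
move=> /ang_polar[hf _ _] /ang_polar[hg _ _].
by rewrite /ang_from; case: ifP => _; case: ifP => _; lra.
Qed.

Lemma wcomp_ang_from (R : realType) (c : R) (v w : seq (affn R)) :
  wincr v -> lid \notin v -> perm_eq v w ->
  pairwise (relpre (ang_from c) <=%R) v -> pairwise (relpre (ang_from c) <=%R) w ->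
  wcomp v = wcomp w.
Proof.
move=> hm hl e hv hw; apply: (wcomp_sorted_key (key := ang_from c)) => // f g fv gv.
have f0 := lid_notin_neq hl fv; have g0 := lid_notin_neq hl gv.
by move=> /(ang_from_inj f0 g0); apply: cross_ang_eq.
Qed.

Lemma ordered_cat (R : realType) (v w : seq (affn R)) :
  ordered v -> ordered w -> {in v & w, forall f g, ang f <= ang g} ->
  ordered (v ++ w).
Proof.
rewrite /ordered pairwise_cat => -> -> h; rewrite !andbT.
by apply/allrelP => f g; apply: h.
Qed.

Lemma ordered_ang_from (R : realType) (c : R) (v w : seq (affn R)) :
  lid \notin v ++ w -> ordered v -> ordered w ->
  {in v, forall f, c <= ang f} -> {in w, forall f, ang f < c} ->
  pairwise (relpre (ang_from c) <=%R) (v ++ w).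
Proof.
move=> hl hv hw hvc hwc; rewrite pairwise_cat; apply/and3P; split.
- apply/allrelP => f g fv gw /=; rewrite /ang_from hvc // (lt_geF (hwc _ gw)).
  have fvw : f \in v ++ w by rewrite mem_cat fv.
  have gvw : g \in v ++ w by rewrite mem_cat gw orbT.
  have [hf _ _] := ang_polar (lid_notin_neq hl fvw).
  by have [hg _ _] := ang_polar (lid_notin_neq hl gvw); lra.
- apply/(pairwiseP lid) => i j hi hj ij /=.
  have /(pairwiseP lid)/(_ _ _ hi hj ij)/= := hv.
  by rewrite /ang_from !hvc ?mem_nth.
- apply/(pairwiseP lid) => i j hi hj ij /=.
  have /(pairwiseP lid)/(_ _ _ hi hj ij)/= := hw.
  by rewrite /ang_from !(lt_geF (hwc _ (mem_nth _ _))) // lerD2r.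
Qed.

(* The steps of [w] pointing exactly opposite to the total displacement can be
   moved from the end to the front without changing the composition. *)
Lemma convex_ang_from (R : realType) (c : R) (w : seq (affn R)) :
  wincr w -> lid \notin w -> antipode (wcomp w) c -> convex_at c w ->
  exists w', [/\ perm_eq w' w, wcomp w' = wcomp w
    & pairwise (relpre (ang_from c) <=%R) w'].
Proof.
move=> hm hl hc [u [v [ew hu hv huc hvc]]]; have pi0 := @pi_gt0 R.
(* [v2] collects the steps of [v] with angle exactly [c]. They close the word in [convex_at] but
   come first for [ang_from c]. *)
pose v1 := [seq f <- v | ang f < c]; pose v2 := [seq f <- v | ~~ (ang f < c)].
have ev : perm_eq v (v1 ++ v2) by rewrite perm_sym perm_filterC.
have sv1 : {in v1, forall f, ang f < c} by move=> f; rewrite mem_filter => /andP[].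
have sv2 : {in v2, forall f, ang f = c}.
  move=> f; rewrite mem_filter -leNgt => /andP[h fv].
  by apply/le_anti; rewrite h hvc.
have [hmu hmv] : wincr u /\ wincr v by apply: wincr_cat; rewrite -ew.
have hlv : lid \notin v by move: hl; rewrite ew mem_cat negb_or => /andP[].
have hv1 : ordered v1 by apply: pairwise_filter.
have hv2 : ordered v2 by apply: pairwise_filter.
have cv : wcomp v = wcomp (v1 ++ v2).
  apply: wcomp_ordered => //; apply: ordered_cat => // f g /sv1 h1 /sv2 ->.
  exact: ltW.
have ew' : perm_eq w ((u ++ v1) ++ v2) by rewrite ew -catA perm_cat2l.
have cw : wcomp w = wcomp ((u ++ v1) ++ v2) by rewrite ew !wcomp_cat cv wcomp_cat lcompA.
exists (v2 ++ u ++ v1); split.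
- by rewrite perm_sym (perm_trans ew') // perm_catC.
- have [hm1 hm2] : wincr (u ++ v1) /\ wincr v2.
    by apply: wincr_cat; apply: wincr_perm hm; rewrite perm_sym.
  rewrite cw !(wcomp_cat v2) !(wcomp_cat _ v2); apply: lcomp_commute.
  (* The block [v2] is parallel to the total displacement, hence to the rest of the word, so it
     commutes with that rest. *)
  have : cross (wcomp v2) (wcomp ((u ++ v1) ++ v2)) = 0.
    rewrite -cw; apply: cross_wcomp_eq0 => // f fv2.
    rewrite (cross_antipode _ hc); last first.
      by apply: (lid_notin_neq hl); rewrite (perm_mem ew') mem_cat fv2 orbT.
    by rewrite sv2 // subrr sin0 mulr0.
  rewrite cross_suffix_prefix => /eqP; rewrite oppr_eq0 mulf_eq0.
  by rewrite gt_eqF ?alpha_wcomp_gt0 //= => /eqP ->.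
- rewrite catA; apply: ordered_ang_from => //.
  + move: hl; rewrite (perm_mem ew') !mem_cat !negb_or.
    by move=> /andP[/andP[-> ->] ->].
  + by apply: ordered_cat => // f g /sv2 -> /huc.
  + by move=> f; rewrite mem_cat => /orP[/sv2 ->|/huc].
Qed.

(* Relative to the direction opposite to the total displacement the steps first
   rise and then descend, and the total rise vanishes. *)
Lemma ang_from_cross_ge0 (R : realType) (c : R) (v w : seq (affn R)) :
  wincr (v ++ w) -> lid \notin v ++ w -> antipode (wcomp (v ++ w)) c ->
  pairwise (relpre (ang_from c) <=%R) (v ++ w) -> 0 <= cross (wcomp v) (wcomp w).
Proof.
move=> hm hl hc; have pi0 := @pi_gt0 R; have [hmv hmw] := wincr_cat hm.
have [V0 hc0 _] := hc.
have sgn f : f \in v ++ w -> exists2 k, 0 < k &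
    cross f (wcomp (v ++ w)) = k * sin (ang_from c f - c).
  move=> /(lid_notin_neq hl) f0; exists (radius f * radius (wcomp (v ++ w))).
    by rewrite mulr_gt0 // radius_gt0.
  rewrite (cross_antipode f0 hc) /ang_from; case: ifP => // _; congr (_ * _).
  by rewrite addrAC mulr_natl sinD2pi.
have itv f : f \in v ++ w -> c <= ang_from c f < c + 2 * pi.
  by move=> /(lid_notin_neq hl); apply: ang_from_itv.
rewrite pairwise_cat => /and3P[/allrelP hvw _ _].
(* Either all of [v] lies in the rising half [[c, c + pi]], or some step of [v] is past it and then
   all of [w] is in the descending half; the total rise being zero, both cases give the same
   sign. *)
have [/allP h|/allPn[f fv]] := boolP (all (fun f => ang_from c f <= c + pi) v).
  rewrite -(cross_prefix_suffix v w); apply: cross_wcomp_ge0 => // f fv.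
  have fvw : f \in v ++ w by rewrite mem_cat fv.
  have [k k0 ->] := sgn f fvw; rewrite mulr_ge0 ?(ltW k0) // sin_ge0_pi //.
  by have := h f fv; have := itv f fvw; lra.
rewrite -ltNge => hf.
have : cross (wcomp w) (wcomp (v ++ w)) <= 0.
  apply: cross_wcomp_le0 => // g gw.
  have gvw : g \in v ++ w by rewrite mem_cat gw orbT.
  have [k k0 ->] := sgn g gvw; rewrite mulr_ge0_le0 ?(ltW k0) // sin_le0_pi //.
  by have := hvw f g fv gw; have := itv g gvw => /=; lra.
by rewrite cross_suffix_prefix oppr_le0 pmulr_rge0 // alpha_wcomp_gt0.
Qed.

(** Cut the sorted word at [c] and [d] into [lo], [mi], [hi]. Read from [c] the angles run through
    [mi], [hi], [lo], and read from [d] through [hi], [lo], [mi]: the two orders differ by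
    exchanging [mi] with [x = hi ++ lo]. *)
Lemma convex_wcomp_eq (R : realType) (c d : R) (v w : seq (affn R)) :
  perm_eq v w -> wincr v -> lid \notin v ->
  antipode (wcomp v) c -> antipode (wcomp w) d -> convex_at c v -> convex_at d w ->
  wcomp v = wcomp w.
Proof.
wlog cd : c d v w / c <= d.
  move=> hw e hm hl hc hd cv cw; have [h|h] := leP c d; first exact: (hw c d).
  symmetry; apply: (hw d c) => //; first exact: ltW.
  - by rewrite perm_sym.
  - by apply: wincr_perm hm; rewrite perm_sym.
  - by rewrite -(perm_mem e).
move=> e hm hl hc hd cv cw; have pi0 := @pi_gt0 R.
have hmw : wincr w by apply: wincr_perm hm; rewrite perm_sym.
have hlw : lid \notin w by rewrite -(perm_mem e).
have [v' [pv' ev' sv']] := convex_ang_from hm hl hc cv.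
have [w' [pw' ew' sw']] := convex_ang_from hmw hlw hd cw.
pose s := sort (relpre ang <=%R) v.
have os : ordered s.
  rewrite /ordered -sorted_pairwise; last by move=> x y z /= ; apply: le_trans.
  by apply: sort_sorted => x y /=; apply: le_total.
have es : perm_eq s v by rewrite perm_sort.
have hls : lid \notin s by rewrite (perm_mem es).
pose lo := [seq f <- s | ang f < c].
pose mi := [seq f <- [seq f <- s | ~~ (ang f < c)] | ang f < d].
pose hi := [seq f <- [seq f <- s | ~~ (ang f < c)] | ~~ (ang f < d)].
have es' : perm_eq s (lo ++ mi ++ hi).
  rewrite perm_sym (perm_trans _ (introT permPl (perm_filterC (fun f => ang f < c) s))) //.
  by rewrite perm_cat2l; apply/permPl/perm_filterC.
have hlo : {in lo, forall f, ang f < c} by move=> f; rewrite mem_filter => /andP[].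
have hmi : {in mi, forall f, c <= ang f < d}.
  by move=> f; rewrite !mem_filter -leNgt => /and3P[h1 h2 _]; apply/andP.
have hhi : {in hi, forall f, d <= ang f}.
  by move=> f; rewrite !mem_filter -!leNgt => /andP[].
have olo : ordered lo by apply: pairwise_filter.
have omi : ordered mi by do 2 apply: pairwise_filter.
have ohi : ordered hi by do 2 apply: pairwise_filter.
pose x := hi ++ lo.
have e1 : perm_eq v (mi ++ x).
  apply: (perm_trans (y := s)); first by rewrite perm_sym.
  by rewrite (perm_trans es') // perm_catC -catA.
have e2 : perm_eq v (x ++ mi) by rewrite (perm_trans e1) // perm_catC.
have s1 : pairwise (relpre (ang_from c) <=%R) (mi ++ x).
  rewrite catA; apply: ordered_ang_from => //.
  - by rewrite -catA -(perm_mem e1).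
  - by apply: ordered_cat => // f g /hmi/andP[_ /ltW h] /hhi; apply: le_trans.
  - by move=> f; rewrite mem_cat => /orP[/hmi/andP[]//|/hhi]; apply: le_trans.
have s2 : pairwise (relpre (ang_from d) <=%R) (x ++ mi).
  rewrite -catA; apply: ordered_ang_from => //.
  - by rewrite catA -(perm_mem e2).
  - by apply: ordered_cat => // f g /hlo/ltW h /hmi/andP[h' _]; apply: le_trans h'.
  - by move=> f; rewrite mem_cat => /orP[/hlo/lt_le_trans->//|/hmi/andP[]].
have c1 : wcomp v = wcomp (mi ++ x).
  rewrite -ev'; apply: (wcomp_ang_from (c := c)) => //.
  - exact: wincr_perm pv' hm.
  - by rewrite (perm_mem pv').
  - exact: perm_trans pv' e1.
have c2 : wcomp w = wcomp (x ++ mi).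
  rewrite -ew'; apply: (wcomp_ang_from (c := d)) => //.
  - exact: wincr_perm pw' hmw.
  - by rewrite (perm_mem pw').
  - by rewrite (perm_trans pw') // perm_sym (perm_trans _ e) // perm_sym.
have hm1 : wincr (mi ++ x) by apply: wincr_perm hm; rewrite perm_sym.
have hm2 : wincr (x ++ mi) by apply: wincr_perm hm; rewrite perm_sym.
(* [g1] and [g2] bound the cross product of the two blocks from opposite sides, so the blocks
   commute. *)
have := ang_from_cross_ge0 (v := mi) (w := x) hm1.
rewrite -(perm_mem e1) -c1 => /(_ _ hl hc s1) g1.
have := ang_from_cross_ge0 (v := x) (w := mi) hm2.
rewrite -(perm_mem e2) -c2 => /(_ _ hl hd s2) g2.
rewrite c1 c2 (wcomp_cat mi) (wcomp_cat x); apply/esym/lcomp_commute/eqP.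
by rewrite eq_le g1 andbT -oppr_ge0 -crossC g2.
Qed.

(** * Counterclockwise words *)

Definition ccw {R : realType} (w : seq (affn R)) : Prop :=
  exists k, sorted <=%R (rot k (map ang w)).

Lemma ccwP (R : realType) (w : seq (affn R)) :
  ccw w <-> exists u v, w = u ++ v /\ ordered (v ++ u).
Proof.
have e s : sorted <=%R (map ang s) = ordered (s : seq (affn R)).
  by rewrite sorted_map sorted_pairwise // => x y z /=; apply: le_trans.
split=> [[k]|[u [v [-> h]]]].
  by rewrite -map_rot e => h; exists (take k w), (drop k w); rewrite cat_take_drop.
by exists (size u); rewrite -map_rot rot_size_cat e.
Qed.

Lemma ccw_rot (R : realType) (v w : seq (affn R)) : ccw (v ++ w) -> ccw (w ++ v).
Proof.
case=> k h; have : v ++ w \in [seq rot m (w ++ v) | m <- iota 0 (size (w ++ v)).+1].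
  apply/mapP; exists (size w); last by rewrite rot_size_cat.
  by rewrite mem_iota size_cat add0n ltnS leq_addr.
case/mapP => m _ e; move: h; rewrite e map_rot rot_rot_add => h; by eexists; exact: h.
Qed.

Lemma ordered_head_le (R : realType) (w : seq (affn R)) (f : affn R) :
  ordered w -> f \in w -> ang (head lid w) <= ang f.
Proof.
case: w => // g w; rewrite /ordered /= => /andP[/allP h _].
by rewrite inE => /orP[/eqP ->|/h].
Qed.

Lemma ordered_le_last (R : realType) (w : seq (affn R)) (f : affn R) :
  ordered w -> f \in w -> ang f <= ang (last lid w).
Proof.
case/lastP: w => // w g; rewrite /ordered pairwise_rcons last_rcons => /andP[/allP h _].
by rewrite mem_rcons inE => /orP[/eqP ->|/h].
Qed.

(** If the extreme angles agreed, all angles would be equal and the word colinear. *)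
Lemma ordered_head_lt_last (R : realType) (w : seq (affn R)) :
  lid \notin w -> ~ colin w -> ordered w -> ang (head lid w) < ang (last lid w).
Proof.
move=> hl hc hw; rewrite ltNge; apply/negP => h; apply: hc => f g fw gw.
apply: cross_ang_eq; [exact: lid_notin_neq fw|exact: lid_notin_neq gw|].
have := (ordered_head_le hw fw, ordered_head_le hw gw).
by have := (ordered_le_last hw fw, ordered_le_last hw gw); case=> ? ? [? ?]; lra.
Qed.

Lemma convex_ccw (R : realType) (c : R) (w : seq (affn R)) : convex_at c w -> ccw w.
Proof.
case=> u [v [-> hu hv huc hvc]]; apply/ccwP; exists u, v; split=> //.
by apply: ordered_cat => // f g /hvc h /huc; apply: le_trans.
Qed.

(** In the cyclic order of the angles the last letter of a counterclockwise word is followed by its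
    first, and convexity asks that [c] lie in the gap between them. *)
Lemma convex_in_arc (R : realType) (a c : R) (w : seq (affn R)) :
  lid \notin w -> ~ colin w -> 0 <= c < 2 * pi -> eqmod2pi c a ->
  convex_at c w <-> ccw w /\ in_arc a (ang (last lid w)) (ang (head lid w)).
Proof.
move=> hl hc c2pi ca.
have [f0 f0w] : exists f, f \in w.
  by case: w hc {hl} => [|f w _]; [case|exists f; rewrite mem_head].
have hw : head lid w \in w by case: w f0w {hl hc} => // f w _; rewrite mem_head.
have lw : last lid w \in w by case: w f0w {hl hc hw} => // f w _; rewrite /= mem_last.
have [lw2pi _ _] := ang_polar (lid_notin_neq hl lw).
have [hw2pi _ _] := ang_polar (lid_notin_neq hl hw).
rewrite (in_arcP c2pi lw2pi hw2pi ca); split.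
  move=> h; split; first exact: convex_ccw h.
  case: h => -[|f u] [v [ew hu hv huc hvc]].
    rewrite ew /= in hw lw hc hl *; have := ordered_head_lt_last hl hc hv.
    by rewrite leNgt => ->; rewrite hvc.
  have c1 : c <= ang (head lid w) by rewrite ew /= huc // mem_head.
  case/lastP: v ew hv hvc => [|v g] ew hv hvc.
    move: ew; rewrite cats0 => ew; rewrite ew in hc hl c1 *.
    by have := ordered_head_lt_last hl hc hu; rewrite leNgt => ->; rewrite c1 orbT.
  have -> : ang (last lid w) <= c by rewrite ew last_cat last_rcons hvc // mem_rcons mem_head.
  by rewrite c1; case: ifP.
case=> /ccwP[u [v [ew hvu]]].
have [hv hu] : ordered v /\ ordered u by move: hvu; rewrite /ordered pairwise_cat => /and3P[].
(* When [w] itself is sorted the gap wraps through 0, so [c] is above all angles or below all of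
   them, and one block of the decomposition is empty. *)
have ord : ordered w ->
    (if ang (last lid w) <= ang (head lid w)
     then ang (last lid w) <= c <= ang (head lid w)
     else (ang (last lid w) <= c) || (c <= ang (head lid w))) -> convex_at c w.
  move=> ow; rewrite leNgt (ordered_head_lt_last hl hc ow) /= => /orP[h|h].
    exists [::], w; split=> // f fw; apply: le_trans h; exact: ordered_le_last.
  exists w, [::]; rewrite cats0; split=> // f fw; apply: (le_trans h); exact: ordered_head_le.
have [u0|un0] := eqVneq u [::]; first by apply: ord; rewrite ew u0; move: hv.
have [v0|vn0] := eqVneq v [::]; first by apply: ord; rewrite ew v0 cats0.
have hhu : head lid w = head lid u by rewrite ew; case: (u) un0.
have hlv : last lid w = last lid v by rewrite ew last_cat; case: (v) vn0.
have hu' : head lid u \in u by case: (u) un0 => // f u' _; rewrite mem_head.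
have lv' : last lid v \in v by case: (v) vn0 => // f v' _; rewrite /= mem_last.
rewrite hhu hlv; have -> : ang (last lid v) <= ang (head lid u).
  by move: hvu; rewrite /ordered pairwise_cat => /and3P[/allrelP h _ _]; apply: h.
case/andP=> h1 h2; exists u, v; split=> // f fw.
  by apply: (le_trans h2); apply: ordered_head_le.
by apply: le_trans h1; apply: ordered_le_last.
Qed.

(** Both words rotate to sorted words, which compose equally. A rotation preserves the composition
    [lid] because a one-sided inverse of an increasing function is two-sided ([linv]). *)
Lemma ccw_lid (R : realType) (v w : seq (affn R)) :
  wincr v -> lid \notin v -> perm_eq v w -> ccw v -> ccw w ->
  wcomp v = lid -> wcomp w = lid.
Proof.
move=> hm hl e /ccwP[a [b [ev hba]]] /ccwP[c [d [ew hdc]]] hv.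
have linv g h : 0 < alpha g -> lcomp g h = lid -> lcomp h g = lid :> affn R.
  case: g h => [a1 b1] [a2 b2]; rewrite /lcomp /lid /alpha /beta /= => a0 [h1 h2].
  congr pair; first by rewrite mulrC.
  by apply: (mulfI (lt0r_neq0 a0)); rewrite mulr0 mulrDr mulrA h1 mul1r addrC.
have [ma mb] : wincr a /\ wincr b by apply: wincr_cat; rewrite -ev.
have mw : wincr w by apply: wincr_perm hm; rewrite perm_sym.
have [mc md] : wincr c /\ wincr d by apply: wincr_cat; rewrite -ew.
rewrite ew wcomp_cat; apply: (linv (wcomp c)); first exact: alpha_wcomp_gt0.
rewrite -wcomp_cat -(@wcomp_ordered _ (b ++ a)) //.
- rewrite wcomp_cat; apply: (linv (wcomp b)); first exact: alpha_wcomp_gt0.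
  by rewrite -wcomp_cat -ev.
- by apply: wincr_perm hm; rewrite ev perm_catC.
- by move: hl; rewrite ev !mem_cat orbC.
- by rewrite perm_catC -ev (perm_trans e) // ew perm_catC.
Qed.

Lemma ccw_path_unimodal (R : realType) (n : nat) (x y : nat -> R) (a b : R) :
  let h k := a * y k - b * x k in
  x 0%N = 0 -> y 0%N = 0 ->
  (forall i j k, (i <= j <= k)%N -> (k <= n)%N ->
     0 <= (x j - x i) * (y k - y j) - (y j - y i) * (x k - x j)) ->
  0 < - (a * x n + b * y n) -> h n = 0 ->
  forall i j k, (i <= j <= k)%N -> (k <= n)%N ->
  h j < h i -> h j < h k -> 0 <= h j -> False.
Proof.
move=> h x0 y0 or an hn i j k /andP[ij jk] kn hji hjk hj0.
have jn := leq_trans jk kn.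
have := or 0%N i j; have := or 0%N j k; have := or i j k; have := or i j n; have := or j k n.
rewrite !leq0n !ij !jk !kn !jn !leqnn /= x0 y0.
move=> /(_ isT isT) o1 /(_ isT isT) o2 /(_ isT isT) o3 /(_ isT isT) o4 /(_ isT isT) o5.
rewrite /h in hji hjk hj0 hn.
set X := x in o1 o2 o3 o4 o5 hji hjk hj0 hn an *.
pose cx := X k - X j; pose cy := y k - y j.
pose bx := X i - X j; pose by' := y i - y j.
pose ex := X n - X j; pose ey := y n - y j.
have hc : 0 < a * cy - b * cx by rewrite /cx /cy; lra.
have hb : 0 < a * by' - b * bx by rewrite /bx /by'; lra.
have he : a * ey - b * ex <= 0 by rewrite /ex /ey; lra.
have ha : a * (- y j) - b * (- X j) <= 0 by lra.
have c1 : 0 <= cx * by' - cy * bx by move: o3; rewrite /cx /cy /bx /by'; lra.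
have c2 : 0 <= ex * by' - ey * bx by move: o2; rewrite /ex /ey /bx /by'; lra.
have c3 : 0 <= cx * ey - cy * ex by move: o1; rewrite /ex /ey /cx /cy; lra.
have c4 : 0 <= - X j * by' + y j * bx by move: o5; rewrite /bx /by'; lra.
have c5 : 0 <= - (cx * y j) + cy * X j by move: o4; rewrite /cx /cy; lra.
(* The identity below is the linear relation between three plane vectors, evaluated at the height
   functional; its right side is nonpositive, so a vector that is not rising and lies between the
   two rising ones in the turning sense is parallel to [(cx, cy)]. *)
have zero (ux uy : R) : a * uy - b * ux <= 0 -> 0 <= ux * by' - uy * bx ->
    0 <= cx * uy - cy * ux -> cx * uy - cy * ux = 0.
  move=> hu u1 u2; apply/eqP; rewrite eq_le u2 andbT -(pmulr_lle0 _ hb).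
  have -> : (cx * uy - cy * ux) * (a * by' - b * bx) =
      (cx * by' - cy * bx) * (a * uy - b * ux) -
      (ux * by' - uy * bx) * (a * cy - b * cx) by ring.
  by rewrite subr_le0 (le_trans (mulr_ge0_le0 c1 hu)) // mulr_ge0 // ltW.
have z1 := zero ex ey he c2 c3.
have z2 : cx * (- y j) - cy * (- X j) = 0.
  by apply: zero => //; lra.
have z3 : cx * y n - cy * X n = 0.
  by move: z1 z2; rewrite /ex /ey; lra.
(* [z3] and [hn] say that both (cx, cy) and (a, b) are parallel to the nonzero
   displacement (x n, y n), so the height difference [hc] vanishes. *)
have : (a * cy - b * cx) * (a * X n + b * y n) = 0.
  have -> : (a * cy - b * cx) * (a * X n + b * y n) =
     (a * y n - b * X n) * (a * cx + b * cy) - (a ^+ 2 + b ^+ 2) * (cx * y n - cy * X n) by ring.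
  by rewrite hn z3; ring.
move/eqP; rewrite mulf_eq0 gt_eqF //= => /eqP e; lra.
Qed.

(** Lift each angle to [L i] in [[c, c + 2 pi]]. A step rises while [L i] is below [c + pi] and
    descends above it, so a decrease of [L] would create a wrong turn or a valley of the height. The
    last hypothesis says that the path leaves its chord. *)
Lemma ccw_path_sorted (R : realType) (n : nat) (x y t r : nat -> R) (c rho : R) :
  x 0%N = 0 -> y 0%N = 0 ->
  (forall i, (i < n)%N -> [/\ 0 < r i, 0 <= t i < 2 * pi,
     x i.+1 - x i = r i * cos (t i) & y i.+1 - y i = r i * sin (t i)]) ->
  (forall i j k, (i <= j <= k)%N -> (k <= n)%N ->
     0 <= (x j - x i) * (y k - y j) - (y j - y i) * (x k - x j)) ->
  0 < rho -> 0 <= c < 2 * pi ->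
  x n = - (rho * cos c) -> y n = - (rho * sin c) ->
  (exists2 k, (k <= n)%N & cos c * y k - sin c * x k != 0) ->
  exists b : nat -> bool,
    (forall i, (i < n)%N -> if b i then t i <= c else c <= t i) /\
    (forall i, (i.+1 < n)%N ->
       t i + (b i)%:R * (2 * pi) <= t i.+1 + (b i.+1)%:R * (2 * pi)).
Proof.
move=> x0 y0 st or rho0 hc xn yn [K Kn hK]; have pi0 := @pi_gt0 R.
pose h k := cos c * y k - sin c * x k.
have cs : cos c * cos c + sin c * sin c = 1 by rewrite -!expr2 cos2Dsin2.
have h0 : h 0%N = 0 by rewrite /h x0 y0; ring.
have hn : h n = 0 by rewrite /h xn yn; ring.
(* The turn at vertex [k] between the two ends of the path is [rho * h k]. *)
have hge0 k : (k <= n)%N -> 0 <= h k.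
  move=> kn; have := or 0%N k n; rewrite kn leqnn x0 y0 xn yn => /(_ isT isT) o.
  by rewrite -(pmulr_rge0 _ rho0) /h; lra.
have hK0 : 0 < h K by rewrite lt_def hK hge0.
have uni i j k : (i <= j <= k)%N -> (k <= n)%N -> h j < h i -> h j < h k -> False.
  move=> ijk kn h1 h2; have jn : (j <= n)%N by case/andP: ijk => _ /leq_trans->.
  apply: (ccw_path_unimodal x0 y0 or _ hn ijk kn h1 h2 (hge0 j jn)).
  have -> : - (cos c * x n + sin c * y n) = rho * (cos c * cos c + sin c * sin c).
    by rewrite xn yn; ring.
  by rewrite cs mulr1.
have hS i : (i < n)%N -> h i.+1 - h i = r i * sin (t i - c).
  move=> /st[_ _ e1 e2]; rewrite sinB.
  have -> : h i.+1 - h i = cos c * (y i.+1 - y i) - sin c * (x i.+1 - x i).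
    by rewrite /h; ring.
  by rewrite e1 e2; ring.
(* Direction [c] is both ends of the window. Such a step is lifted exactly when a vertex of positive
   height occurs up to its starting vertex [i]. *)
pose b i := (t i < c) || ((t i == c) && has (fun m => 0 < h m) (iota 0 i.+1)).
pose L i := t i + (b i)%:R * (2 * pi).
have seen i : (i < n)%N -> L i = c + 2 * pi ->
    t i = c /\ exists2 m, (m <= i)%N & 0 < h m.
  move=> hi; have [_ ht _ _] := st i hi; rewrite /L.
  have [hb|_] := boolP (b i); last by rewrite mul0r addr0 => e; lra.
  rewrite mul1r => /addIr e; split=> //.
  move: hb; rewrite /b e ltxx eqxx orFb andTb => /hasP [m].
  by rewrite mem_iota => /andP[_ hm] ?; exists m.
have unseen i : (i < n)%N -> L i = c -> t i = c /\ forall m, (m <= i)%N -> h m = 0.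
  move=> hi; have [_ ht _ _] := st i hi; rewrite /L.
  have [_|hb] := boolP (b i); first by rewrite mul1r => e; lra.
  rewrite mul0r addr0 => e; split=> // m mi; apply/eqP.
  rewrite eq_le hge0 ?(leq_trans mi) 1?ltnW // andbT leNgt.
  move: hb; rewrite /b e ltxx eqxx orFb andTb => /hasPn; apply.
  by rewrite mem_iota add0n ltnS.
have Litv i : (i < n)%N -> c <= L i <= c + 2 * pi.
  move=> /st[_ ht _ _]; rewrite /L /b; case: (ltgtP (t i) c) => h1.
  - by rewrite orTb mul1r; lra.
  - by rewrite andFb orbF mul0r; lra.
  - by rewrite orFb andTb; case: (has _ _); rewrite ?mul1r ?mul0r; lra.
have Lmod i : eqmod2pi (L i) (t i).
  rewrite /L; case: (b i); last by exists 0; rewrite !mul0r; ring.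
  by exists 1; rewrite !mul1r; ring.
(* A step in the direction [c] is impossible at positive height. *)
have low i : (i < n)%N -> t i = c -> h i = 0 /\ h i.+1 = 0.
  move=> hi e; have [r0 _ e1 e2] := st i hi.
  have := hS i hi; rewrite e subrr sin0 mulr0 => /subr0_eq ->.
  suff -> : h i = 0 by [].
  apply/eqP; rewrite eq_le (hge0 i (ltnW hi)) andbT -(pmulr_rle0 _ r0).
  have := or 0%N i i.+1; rewrite leq0n leqnSn hi e1 e2 e x0 y0 => /(_ isT isT) o.
  by rewrite /h; lra.
exists b; split.
  move=> i hi; have [_ ht _ _] := st i hi; have := Litv i hi; rewrite /L.
  by case: (b i); rewrite ?mul1r ?mul0r; lra.
move=> i hi; have hi' := ltnW hi; rewrite -/(L i) -/(L i.+1) leNgt; apply/negP => lt.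
have Li := Litv i hi'; have Li1 := Litv _ hi.
have [r0 _ e1 e2] := st i hi'; have [r1 _ e3 e4] := st _ hi.
have [cLi sLi] := cos_sin_eqmod2pi (Lmod i).
have [cLi1 sLi1] := cos_sin_eqmod2pi (Lmod i.+1).
have sL j : (j < n)%N -> h j.+1 - h j = r j * sin (L j - c).
  move=> hj; rewrite hS // !sinB.
  by have [-> ->] := cos_sin_eqmod2pi (Lmod j).
(* A decrease by less than [pi] would be a clockwise turn at vertex [i.+1]. *)
have d_ge : pi <= L i - L i.+1.
  rewrite leNgt; apply/negP => d; have := @sin_gt0_pi R (L i - L i.+1).
  have := or i i.+1 i.+2; rewrite !leqnSn hi => /(_ isT isT).
  rewrite e1 e2 e3 e4 -cLi -sLi -cLi1 -sLi1 sinB => o1 o2.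
  have {o2} : 0 < sin (L i) * cos (L i.+1) - cos (L i) * sin (L i.+1) by apply: o2; lra.
  rewrite -(pmulr_rgt0 _ (mulr_gt0 r0 r1)); lra.
(* Against a step of direction [c + pi], the cross product measures the height of [(u, v)]. *)
have par j u v : (j < n)%N -> L j = c + pi ->
    u * (y j.+1 - y j) - v * (x j.+1 - x j) = r j * (cos c * v - sin c * u).
  move=> hj e; have [_ _ -> ->] := st j hj.
  have [<- <-] := cos_sin_eqmod2pi (Lmod j).
  by rewrite e sinDpi cosDpi; ring.
(* Here the path is still on the chord, so step [i] is horizontal. Direction [c + pi] makes a wrong
   turn towards the later vertex [K], and [c + 2 pi] needs an earlier positive height. *)
have [e|ne] := eqVneq (L i.+1) c.
  have [_ z] := unseen _ hi e.
  have z1 : h i.+1 = 0 by apply: z.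
  have z0 : h i = 0 by apply: z.
  have : sin (L i - c - pi) = 0.
    rewrite sinB sinpi cospi; have := sL i hi'; rewrite z0 z1 subrr => /esym/eqP.
    by rewrite mulf_eq0 gt_eqF //= => /eqP ->; ring.
  case/sin_eq0_pi => [|e0|e0]; first by lra.
    have iK : (i.+1 < K)%N.
      by rewrite ltnNge; apply/negP => /z e'; move: hK0; rewrite e' ltxx.
    have := or i i.+1 K; rewrite leqnSn (ltnW iK) => /(_ isT Kn).
    have := par i (x K - x i.+1) (y K - y i.+1) hi'.
    have eLi : L i = c + pi by lra.
    move=> /(_ eLi) p1 o1.
    have : 0 < r i * h K by rewrite mulr_gt0.
    have -> : h K = h K - h i.+1 by rewrite z1 subr0.
    by rewrite /h; lra.
  have [_ [m mi hm]] := seen _ hi' (ltac:(lra)).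
  by move: hm; rewrite z ?ltxx // leqW.
(* Here the path is back on the chord after the positive height at [m]: the next step makes a wrong
   turn if it has direction [c + pi], and otherwise rises, leaving a valley at [i.+1]. *)
have [hLi|hLi] := eqVneq (L i) (c + 2 * pi).
  have [ti [m mi hm]] := seen _ hi' hLi.
  have [z0 z1] := low _ hi' ti.
  have [e|ne'] := eqVneq (L i.+1) (c + pi).
    have := or m i.+1 i.+2; rewrite leqW // leqnSn hi => /(_ isT isT).
    rewrite (par _ _ _ hi e) pmulr_rge0 //.
    have -> : cos c * (y i.+1 - y m) - sin c * (x i.+1 - x m) = h i.+1 - h m.
      by rewrite /h; ring.
    by rewrite z1; lra.
  apply: (uni m i.+1 i.+2); rewrite ?leqnSn ?leqW // z1 //.
  have := sL _ hi; rewrite z1 subr0 => ->; rewrite mulr_gt0 // sin_gt0_pi //.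
  by move: ne ne'; rewrite !neq_lt; lra.
(* Away from the ends of the window, step [i] strictly descends and step [i.+1] strictly rises. *)
apply: (uni i i.+1 i.+2); rewrite ?leqnSn //.
  rewrite -subr_lt0 sL // pmulr_rlt0 // sin_lt0_pi //.
  by move: ne hLi; rewrite !neq_lt; lra.
rewrite -subr_gt0 sL // pmulr_rgt0 // sin_gt0_pi //.
by move: ne hLi; rewrite !neq_lt; lra.
Qed.

(** * Optimal words are convex and counterclockwise *)

(* Any three vertices of the broken line of [w] are oriented counterclockwise. *)
Definition turning {R : realType} (w : seq (affn R)) : Prop :=
  forall a u v b, w = a ++ u ++ v ++ b -> 0 <= cross (wcomp u) (wcomp v).

Lemma optimal_turning (R : realType) (w : seq (affn R)) :
  wincr w -> optimal w -> turning w.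
Proof.
move=> hm ho a u v b e; apply: (optimal_cross_ge0 (a := a) (b := b)); rewrite -?e //.
by move=> f fb; apply: hm; rewrite e !mem_cat fb !orbT.
Qed.

(** Unlifted angles stay below 2 pi, so in a nondecreasing sequence a lifted index is followed only
    by lifted ones; cut the word at the first of them. *)
Lemma convex_of_lift (R : realType) (c : R) (w : seq (affn R)) (b : nat -> bool) :
  lid \notin w ->
  let t i := ang (nth lid w i) in
  (forall i, (i < size w)%N -> if b i then t i <= c else c <= t i) ->
  (forall i, (i.+1 < size w)%N ->
     t i + (b i)%:R * (2 * pi) <= t i.+1 + (b i.+1)%:R * (2 * pi)) ->
  convex_at c w.
Proof.
move=> hl t hb hs.
have ht i : (i < size w)%N -> 0 <= t i < 2 * pi.
  by move=> hi; have [] := ang_polar (lid_notin_neq hl (mem_nth lid hi)).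
have mono i j : (i <= j < size w)%N ->
    t i + (b i)%:R * (2 * pi) <= t j + (b j)%:R * (2 * pi).
  elim: j => [|j ih]; first by rewrite leqn0 => /andP[/eqP -> _].
  move=> /andP[]; rewrite leq_eqVlt => /orP[/eqP -> //|ij] hj.
  by apply: le_trans (hs j hj); apply: ih; rewrite -ltnS ij ltnW.
have bmono i j : (i <= j < size w)%N -> b i -> b j.
  move=> hij bi; apply: contraT => bj; have := mono i j hij.
  have /andP[ij hj] := hij; have := ht j hj; have := ht i (leq_ltn_trans ij hj).
  by rewrite bi (negPf bj) mul1r mul0r; lra.
(* If nothing is lifted, [k] is [size w] and the second block is empty. *)
pose k := find b (iota 0 (size w)).
have kw : (k <= size w)%N by rewrite -[X in (_ <= X)%N](size_iota 0) find_size.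
have lo i : (i < k)%N -> b i = false.
  move=> ik; have := before_find 0%N ik.
  by rewrite nth_iota // (leq_trans ik).
have hi i : (k <= i < size w)%N -> b i.
  move=> /andP[ki iw]; have kw' := leq_ltn_trans ki iw.
  apply: (bmono k); rewrite ?ki //.
  have := nth_find 0%N (_ : has b (iota 0 (size w))).
  by rewrite -/k nth_iota //; apply; rewrite has_find size_iota.
have su : size (take k w) = k by rewrite size_takel.
exists (take k w), (drop k w); split; first by rewrite cat_take_drop.
- apply/(pairwiseP lid) => i j; rewrite !inE su => ik jk ij.
  have jw := leq_trans jk kw; rewrite /= !nth_take //.
  by have := mono i j; rewrite (ltnW ij) jw => /(_ isT); rewrite !lo // !mul0r !addr0.
- apply/(pairwiseP lid) => i j; rewrite !inE size_drop !ltn_subRL => ik jk ij.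
  rewrite /= !nth_drop; have := mono (k + i)%N (k + j)%N.
  by rewrite leq_add2l (ltnW ij) jk => /(_ isT); rewrite !hi ?leq_addr // lerD2r.
- move=> f /(nthP lid)[i]; rewrite su => ik <-; rewrite nth_take //.
  by have := hb i (leq_trans ik kw); rewrite lo.
- move=> f /(nthP lid)[i]; rewrite size_drop ltn_subRL => ik <-; rewrite nth_drop.
  by have := hb _ ik; rewrite hi // leq_addr.
Qed.

(** Vertex [k] of the path is the vector of the prefix of length [k], scaled by the slope [q k] of
    the remaining suffix. Every block then contributes a positive multiple of its own vector, and
    the path ends at the total displacement. *)
Lemma turning_convex (R : realType) (c : R) (w : seq (affn R)) :
  wincr w -> lid \notin w -> ~ colin w -> turning w -> antipode (wcomp w) c ->
  convex_at c w.
Proof.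
move=> hm hl hcol htr hc; have [V0 c2pi _] := hc; have [xV yV] := antipode_polar hc.
pose q k := alpha (wcomp (drop k w)).
pose x k := q k * beta (wcomp (take k w)).
pose y k := q k * (1 - alpha (wcomp (take k w))).
have q0 k : 0 < q k.
  by apply: alpha_wcomp_gt0 => f fw; apply: hm; apply: mem_drop fw.
have x0 : x 0%N = 0 by rewrite /x take0 mulr0.
have y0 : y 0%N = 0 by rewrite /y take0 subrr mulr0.
pose B i j := take (j - i) (drop i w).
have tk i j : (i <= j)%N -> take j w = take i w ++ B i j.
  by move=> ij; rewrite /B -takeD subnKC.
have dr i j : (i <= j)%N -> drop i w = B i j ++ drop j w.
  by move=> ij; rewrite -{1}(cat_take_drop (j - i) (drop i w)) drop_drop subnK.
have qE i j : (i <= j)%N -> q i = q j * alpha (wcomp (B i j)).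
  by move=> ij; rewrite /q (dr i j ij) wcomp_cat.
have xB i j : (i <= j)%N -> x j - x i = q j * beta (wcomp (B i j)).
  move=> ij; rewrite /x (qE i j ij) (tk i j ij) wcomp_cat /lcomp /alpha /beta /=; ring.
have yB i j : (i <= j)%N -> y j - y i = q j * (1 - alpha (wcomp (B i j))).
  move=> ij; rewrite /y (qE i j ij) (tk i j ij) wcomp_cat /lcomp /alpha /beta /=; ring.
pose t i := ang (nth lid w i); pose r i := q i.+1 * radius (nth lid w i).
have st i : (i < size w)%N -> [/\ 0 < r i, 0 <= t i < 2 * pi,
    x i.+1 - x i = r i * cos (t i) & y i.+1 - y i = r i * sin (t i)].
  move=> hi; have f0 := lid_notin_neq hl (mem_nth lid hi).
  have [ht e1 e2] := ang_polar f0.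
  have e : wcomp (B i i.+1) = nth lid w i.
    by rewrite /B subSnn (drop_nth lid hi) /= take0 /wcomp /= lcompidr.
  split=> //; first by rewrite mulr_gt0 // radius_gt0.
  - by rewrite xB // e e1 mulrA.
  - by rewrite yB // e e2 mulrA.
have or i j k : (i <= j <= k)%N -> (k <= size w)%N ->
    0 <= (x j - x i) * (y k - y j) - (y j - y i) * (x k - x j).
  move=> /andP[ij jk] kw; rewrite !xB // !yB //.
  have -> : forall b1 a1 b2 a2 : R, q j * b1 * (q k * a2) - q j * a1 * (q k * b2)
    = q j * q k * (b1 * a2 - a1 * b2) by move=> *; ring.
  rewrite mulr_ge0 ?mulr_ge0 ?(ltW (q0 _)) //.
  apply: (htr (take i w) _ _ (drop k w)).
  by rewrite -(dr j k jk) -(dr i j ij) cat_take_drop.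
have xn : x (size w) = - (radius (wcomp w) * cos c).
  by rewrite /x /q drop_size take_size -xV /wcomp /alpha /= mul1r.
have yn : y (size w) = - (radius (wcomp w) * sin c).
  by rewrite /y /q drop_size take_size -yV /wcomp /alpha /= mul1r.
have [b [hb1 hb2]] : exists b : nat -> bool,
    (forall i, (i < size w)%N -> if b i then t i <= c else c <= t i) /\
    (forall i, (i.+1 < size w)%N ->
       t i + (b i)%:R * (2 * pi) <= t i.+1 + (b i.+1)%:R * (2 * pi)).
  apply: (ccw_path_sorted x0 y0 st or (radius_gt0 V0) c2pi xn yn).
  (* A path that never leaves the chord has all its steps parallel to [c]. *)
  apply: contrapT => hno; apply: hcol.
  have h0 k : (k <= size w)%N -> cos c * y k - sin c * x k = 0.
    by move=> kw; apply/eqP; apply: contrapT => /negP hk; apply: hno; exists k.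
  have hs f : f \in w -> sin (ang f - c) = 0.
    move=> /(nthP lid)[i hi <-]; rewrite -/(t i); have [r0 _ e1 e2] := st i hi.
    have := h0 i (ltnW hi); have := h0 _ hi => h1 h2.
    apply/eqP; rewrite -[_ == 0]orFb -(gt_eqF r0) -mulf_eq0 sinB; apply/eqP.
    have -> : r i * (sin (t i) * cos c - cos (t i) * sin c) =
      cos c * (r i * sin (t i)) - sin c * (r i * cos (t i)) by ring.
    by rewrite -e1 -e2; lra.
  move=> f g fw gw; rewrite cross_ang ?(lid_notin_neq hl fw) ?(lid_notin_neq hl gw) //.
  have -> : ang g - ang f = (ang g - c) - (ang f - c) by ring.
  by rewrite sinB (hs f fw) (hs g gw); ring.
exact: convex_of_lift hb1 hb2.
Qed.

(* A closed path is handled by closing up the path without its first step. *)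
Lemma turning_ccw (R : realType) (w : seq (affn R)) :
  wincr w -> lid \notin w -> ~ colin w -> turning w -> ccw w.
Proof.
move=> hm hl hcol htr; have [V0|V0] := eqVneq (wcomp w) lid; last first.
  have [c hc] := antipode_exists V0.
  by apply: convex_ccw (turning_convex hm hl hcol htr hc).
case: w hm hl hcol htr V0 => [|f w] hm hl hcol htr V0; first by exists 0%N.
have f0 : f != lid by apply: (lid_notin_neq hl); rewrite mem_head.
have hmw : wincr w by move=> g gw; apply: hm; rewrite inE gw orbT.
have hlw : lid \notin w by move: hl; rewrite inE negb_or => /andP[].
have af : 0 < alpha f by apply: hm; rewrite mem_head.
move: V0; rewrite wcomp_cons => -[ea eb].
have W0 : wcomp w != lid.
  apply: contraNneq f0 => e; move: ea eb; rewrite e /alpha /beta /= mul1r mul1r addr0.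
  by case: (f) => ? ? /= -> ->.
have e1 : beta (wcomp w) = - (alpha (wcomp w) * beta f) by lra.
have e2 : 1 - alpha (wcomp w) = - (alpha (wcomp w) * (1 - alpha f)).
  by rewrite mulrBr ea; ring.
have crs g : cross g (wcomp w) = - (alpha (wcomp w) * cross g f).
  by rewrite /cross e1 e2; ring.
have aw := alpha_wcomp_gt0 hmw.
(* The path closes up, so the displacement of the remaining steps is opposite to the first step
   [f]. *)
have pf : antipode (wcomp w) (ang f).
  have [c hc] := antipode_exists W0; suff -> : ang f = c by [].
  have [hf e3 e4] := ang_polar f0; have [_ c2pi _] := hc.
  have [e5 e6] := antipode_polar hc.
  apply: (@polar_unique_scaled _ (alpha (wcomp w) * radius f) (radius (wcomp w))) => //.
  - by rewrite mulr_gt0 // radius_gt0.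
  - exact: radius_gt0.
  - by rewrite -mulrA -e3; lra.
  - by rewrite -mulrA -e4; lra.
have ncw : ~ colin w.
  move=> cw; apply: hcol.
  have cwf g : g \in w -> cross g f = 0.
    move=> gw; have : cross g (wcomp w) = 0.
      by rewrite crossC cross_wcomp_eq0 ?oppr0 // => g' gw'; apply: cw.
    rewrite crs => /eqP; rewrite oppr_eq0 mulf_eq0 gt_eqF ?alpha_wcomp_gt0 //=.
    by move/eqP.
  move=> g h; rewrite !inE => /orP[/eqP ->|gw] /orP[/eqP ->|hw]; first exact: crossff.
  - by rewrite crossC cwf ?oppr0.
  - exact: cwf.
  - exact: cw.
have htw : turning w by move=> a u v b e; apply: (htr (f :: a) _ _ b); rewrite e.
have [u [v [ew hu hv huc hvc]]] := turning_convex hmw hlw ncw htw pf.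
(* The angle of [f] is the cutting angle itself, hence minimal in the first block, and [f] can be
   put back in front. *)
apply: (@convex_ccw _ (ang f)); exists (f :: u), v; split=> //.
- by rewrite ew.
- by rewrite /ordered /= -/(ordered u) hu andbT; apply/allP => g /huc.
- by move=> g; rewrite inE => /orP[/eqP ->|/huc].
Qed.

(** * From permutations to words without identities *)

Definition word {R : realType} {n : nat} (fs : 'I_n -> affn R) (s : 'S_n) :
    seq (affn R) :=
  [seq fs (s i) | i <- enum 'I_n].

Definition core {R : realType} (w : seq (affn R)) : seq (affn R) :=
  [seq f <- w | f != lid].

Lemma lid_notin_core (R : realType) (w : seq (affn R)) : lid \notin core w.
Proof. by rewrite mem_filter eqxx. Qed.

Lemma wcomp_core (R : realType) (w : seq (affn R)) : wcomp (core w) = wcomp w.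
Proof.
elim: w => //= f w ih; case: eqVneq => [->|_] /=; last by rewrite !wcomp_cons ih.
by rewrite wcomp_cons lcompidr.
Qed.

Lemma identicalE (R : realType) (f : affn R) : identical f <-> f = lid.
Proof.
split=> [h|-> x]; last by rewrite /app /alpha /beta /= mul1r addr0.
have := h 0; have := h 1; case: f {h} => a b.
by rewrite /app /alpha /beta /= => h1 h2; congr pair; lra.
Qed.

Lemma fsigE (R : realType) (n : nat) (fs : 'I_n -> affn R) (s : 'S_n) :
  fsig fs s = wcomp (core (word fs s)).
Proof. by rewrite wcomp_core /fsig /wcomp /word; elim: (enum _) lid => /=. Qed.

Lemma angle_seqE (R : realType) (n : nat) (fs : 'I_n -> affn R) (s : 'S_n) :
  angle_seq fs s = map ang (core (word fs s)).
Proof.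
rewrite /angle_seq /word; elim: (enum 'I_n) => //= i l ih.
case: (eqVneq (fs (s i)) lid) => [->|h]; first by rewrite theta_lid.
by rewrite theta_Some //= ih.
Qed.

Lemma counterclockwiseE (R : realType) (n : nat) (fs : 'I_n -> affn R) (s : 'S_n) :
  counterclockwise fs s <-> ccw (core (word fs s)).
Proof. by rewrite /counterclockwise /ccw angle_seqE. Qed.

Lemma word_perm (R : realType) (n : nat) (fs : 'I_n -> affn R) (s r : 'S_n) :
  perm_eq (word fs s) (word fs r).
Proof.
have h (p : 'S_n) : perm_eq (word fs p) (map fs (enum 'I_n)).
  rewrite /word (map_comp fs p); apply: perm_map; apply: uniq_perm.
  - by rewrite map_inj_uniq ?enum_uniq //; apply: perm_inj.
  - exact: enum_uniq.
  - by move=> i; rewrite mem_enum inE; apply/mapP; exists ((p^-1)%g i); rewrite ?mem_enum ?permKV.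
by rewrite (perm_trans (h s)) // perm_sym.
Qed.

Lemma core_word_perm (R : realType) (n : nat) (fs : 'I_n -> affn R) (s r : 'S_n) :
  perm_eq (core (word fs s)) (core (word fs r)).
Proof. by apply: perm_filter; apply: word_perm. Qed.

Lemma word_surj (R : realType) (n : nat) (fs : 'I_n -> affn R) (v : seq (affn R)) (s : 'S_n) :
  perm_eq v (word fs s) -> exists r : 'S_n, v = word fs r.
Proof.
have e : word fs 1%g = [tuple fs i | i < n].
  by rewrite /word /=; apply: eq_map => i; rewrite perm1.
move=> h; have := perm_trans h (word_perm fs s 1%g); rewrite e => /tuple_permP[p ->].
exists p; rewrite /word /=; apply: eq_map => i.
by rewrite tnth_mktuple.
Qed.

(** Appending the discarded identities [z] to [v] yields a rearrangement of the full word. *)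
Lemma core_surj (R : realType) (n : nat) (fs : 'I_n -> affn R) (v : seq (affn R)) (s : 'S_n) :
  perm_eq v (core (word fs s)) -> exists r : 'S_n, v = core (word fs r).
Proof.
move=> h; pose z := [seq f <- word fs s | ~~ (f != lid)].
have [r er] : exists r : 'S_n, v ++ z = word fs r.
  apply: (word_surj (s := s)); rewrite (perm_trans (y := core (word fs s) ++ z)) //.
    by rewrite perm_cat2r.
  by apply/permPl/perm_filterC.
exists r; rewrite -er /core filter_cat.
have -> : [seq f <- z | f != lid] = [::].
  rewrite -filter_predI; apply/eqP; rewrite -size_eq0 size_filter -leqn0 leqNgt.
  by rewrite -has_count; apply/hasPn => f _ /=; case: eqP.
rewrite cats0; apply/esym/all_filterP/allP => f; rewrite (perm_mem h).
exact: lid_notin_neq (lid_notin_core _).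
Qed.

(** All rearrangements have the same slope, so comparing values at 0 suffices. *)
Lemma is_minimumE (R : realType) (n : nat) (fs : 'I_n -> affn R) (s : 'S_n) :
  is_minimum fs s <-> optimal (core (word fs s)).
Proof.
split=> [h v hv|h r x].
  have [r ->] := core_surj hv; have := h r 0.
  by rewrite !fsigE /app !mulr0 !add0r.
by rewrite !fsigE /app (alpha_wcomp_perm (core_word_perm fs s r)) lerD2l h // core_word_perm.
Qed.

Lemma minimum_exists (R : realType) (n : nat) (fs : 'I_n -> affn R) :
  exists s : 'S_n, is_minimum fs s.
Proof.
pose F (s : 'S_n) := beta (wcomp (core (word fs s))).
case: (@Order.TotalTheory.arg_minP _ _ _ (1%g : 'S_n) predT F isT) => s _ hs.
exists s; apply/is_minimumE => v hv; have [r ->] := core_surj hv.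
exact: hs.
Qed.

(** For the converse the common direction is the angle of any non-identical function, and 0 if there
    is none. *)
Lemma colinearE (R : realType) (n : nat) (fs : 'I_n -> affn R) (s : 'S_n) :
  colinear fs <-> colin (core (word fs s)).
Proof.
have inw i : fs i \in word fs s.
  by apply/mapP; exists ((s^-1)%g i); rewrite ?mem_enum ?permKV.
split=> [[l hl] f g|h].
  have sl f' : f' \in core (word fs s) -> sin (ang f' - l) = 0.
    rewrite mem_filter => /andP[f0 /mapP[i _ e]]; have := hl (s i).
    rewrite -e theta_Some // => -[//|[t [[<-] ht]]]; rewrite sinB.
    case: ht => /cos_sin_eqmod2pi[-> ->]; first by ring.
    by rewrite sinDpi cosDpi; ring.
  move=> fw gw; have hw := lid_notin_core (word fs s).
  rewrite cross_ang ?(lid_notin_neq hw fw) ?(lid_notin_neq hw gw) //.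
  have -> : ang g - ang f = (ang g - l) - (ang f - l) by ring.
  by rewrite sinB (sl f fw) (sl g gw); ring.
have [e|[f0 f0w]] : (core (word fs s) = [::]) \/ exists f0, f0 \in core (word fs s).
  by case: (core _) => [|f0 l]; [left|right; exists f0; rewrite mem_head].
  exists 0 => i; left; have [->|h0] := eqVneq (fs i) lid; first exact: theta_lid.
  have : fs i \in core (word fs s) by rewrite mem_filter h0 inw.
  by rewrite e.
exists (ang f0) => i; have [->|h0] := eqVneq (fs i) lid; first by left; exact: theta_lid.
right; exists (ang (fs i)); split; first exact: theta_Some.
have n0 := lid_notin_neq (lid_notin_core _) f0w.
have : cross f0 (fs i) = 0 by apply: h; rewrite // mem_filter h0 inw.
rewrite cross_ang // => /eqP; rewrite mulf_eq0 gt_eqF ?mulr_gt0 ?radius_gt0 //= => /eqP hs.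
have [hf _ _] := ang_polar n0; have [hi _ _] := ang_polar h0.
have [hle|hlt] := leP (ang f0) (ang (fs i)).
  case: (sin_eq0_pi _ hs) => [|e|e]; first by lra.
    by left; exists 0; rewrite e mul0r.
  by right; exists 0; rewrite mul0r; lra.
have hs' : sin (ang f0 - ang (fs i)) = 0 by rewrite -[_ - _]opprB sinN hs oppr0.
case: (sin_eq0_pi _ hs') => [|e|e]; first by lra.
  by left; exists 0; rewrite mul0r; lra.
by right; exists (-1); rewrite mulrNz; lra.
Qed.

(** The non-identical positions form an increasing list [F], so its ends are the smallest and
    largest such indices and give the first and last letters of the core. *)
Lemma arc_conditionE (R : realType) (n : nat) (fs : 'I_n -> affn R) (s : 'S_n)
    (w := core (word fs s)) : w <> [::] ->
  arc_condition fs s <->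
  wcomp w <> lid /\ in_arc (ang (wcomp w) + pi) (ang (last lid w)) (ang (head lid w)).
Proof.
move=> wn; pose P (i : 'I_n) := fs (s i) != lid; pose F := [seq i <- enum 'I_n | P i].
have ew : w = [seq fs (s i) | i <- F] by rewrite /w /core /word filter_map.
have sF : pairwise (fun i j : 'I_n => (i <= j)%N) F.
  apply: pairwise_filter; rewrite -(pairwise_map val leq) val_enum_ord.
  by rewrite -sorted_pairwise ?iota_sorted //; apply: leq_trans.
have inF j : (j \in F) = P j by rewrite mem_filter mem_enum andbT.
have thP j : theta (fs (s j)) <> None <-> P j.
  by rewrite /P; case: eqVneq => [->|h]; rewrite ?theta_lid ?theta_Some.
case eF: F sF => [|j0 F'] sF; first by case: wn; rewrite ew eF.
pose j1 := last j0 F'.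
have j0F : j0 \in F by rewrite eF mem_head.
have j1F : j1 \in F by rewrite eF mem_last.
have p0 : fs (s j0) != lid by have := j0F; rewrite inF.
have lo j : P j -> (j0 <= j)%N.
  rewrite -inF eF inE => /orP[/eqP -> //|]; move: sF => /= /andP[/allP h _]; exact: h.
have hi j : P j -> (j <= j1)%N.
  rewrite -inF eF /j1; case/lastP: F' sF {eF j1F j1} => [|F' j1] sF.
    by rewrite inE => /eqP ->.
  move: sF; rewrite -rcons_cons pairwise_rcons last_rcons => /andP[/allP h _].
  by rewrite mem_rcons inE => /orP[/eqP -> //|/h].
have p1 : fs (s j1) != lid by have := j1F; rewrite inF.
have hw : head lid w = fs (s j0) by rewrite ew eF.
have lw : last lid w = fs (s j1) by rewrite ew eF /= (last_map (fun i => fs (s i))).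
rewrite hw lw; split.
  case=> i0 [i1 [a [a0 [a1]]]]; rewrite fsigE -/w => -[ha h0 h1 hij].
  have i0P : P i0 by apply/thP; rewrite h0.
  have i1P : P i1 by apply/thP; rewrite h1.
  have e0 : i0 = j0.
    apply/val_inj/eqP; rewrite eqn_leq (lo _ i0P) andbT.
    by have /andP[] := hij j0 (iffRL (thP j0) p0).
  have e1 : i1 = j1.
    apply/val_inj/eqP; rewrite eqn_leq (hi _ i1P) /=.
    by have /andP[] := hij j1 (iffRL (thP j1) p1).
  have V0 : wcomp w != lid by apply/eqP => e; move: ha; rewrite e theta_lid.
  move: ha h0 h1; rewrite e0 e1 !theta_Some // => -[<-] [<-] [<-] h.
  by split; [apply/eqP|].
case=> /eqP V0 h; exists j0, j1, (ang (wcomp w)), (ang (fs (s j0))), (ang (fs (s j1))).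
rewrite fsigE !theta_Some //; split=> // j /thP hj.
by rewrite lo // hi.
Qed.

(** * Rotations of optimal words, and the characterisation of minimum permutations *)

(** [cross f g] times either coordinate of the vector of [h] is a combination of [cross f h] and
    [cross g h], and one coordinate is nonzero. *)
Lemma cross_parallel (R : realType) (f g h : affn R) :
  h <> lid -> cross f h = 0 -> cross g h = 0 -> cross f g = 0.
Proof.
move=> /eqP; rewrite -fvec_eq0 negb_and => hh fh gh.
have e1 : cross f g * beta h = 0.
  have -> : cross f g * beta h = cross f h * beta g - cross g h * beta f.
    by rewrite /cross; ring.
  by rewrite fh gh; ring.
have e2 : cross f g * (1 - alpha h) = 0.
  have -> : cross f g * (1 - alpha h) =
      cross f h * (1 - alpha g) - cross g h * (1 - alpha f).
    by rewrite /cross; ring.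
  by rewrite fh gh; ring.
case/orP: hh => hh; apply/eqP.
  by move/eqP: e1; rewrite mulf_eq0 (negPf hh) orbF.
by move/eqP: e2; rewrite mulf_eq0 (negPf hh) orbF.
Qed.

(* If every cyclic rotation is optimal then all proper prefixes, hence all
   steps, are parallel to the total displacement. *)
Lemma rotations_optimal_colin (R : realType) (w : seq (affn R)) :
  wcomp w <> lid ->
  (forall u v, w = u ++ v -> optimal (v ++ u)) -> colin w.
Proof.
move=> V0 ho.
have pre u v : w = u ++ v -> cross (wcomp u) (wcomp w) = 0.
  move=> e; rewrite e cross_prefix_suffix crossC; apply/eqP; rewrite oppr_eq0.
  rewrite -beta_lcompC subr_eq0 -!wcomp_cat eq_le; apply/andP; split.
    by apply: (ho (u ++ v) [::]); rewrite ?cats0 // perm_catC.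
  by apply: ho => //; rewrite perm_catC.
have par f : f \in w -> cross f (wcomp w) = 0.
  move=> /splitPr fw; case: fw pre {V0 ho} => u v pre.
  have h1 := pre u (f :: v) erefl.
  have := pre (rcons u f) v; rewrite cat_rcons => /(_ erefl).
  by rewrite -cats1 wcomp_cat cross_lcompl h1 mulr0 add0r {1}/wcomp /= lcompidr.
by move=> f g fw gw; apply: cross_parallel V0 (par f fw) (par g gw).
Qed.

Theorem theorem1p1 (R : realType) (n : nat) (fs : 'I_n -> affn R)
  (hmono : forall i, 0 < alpha (fs i)) :
  [/\ colinear fs <-> (forall s : 'S_n, is_minimum fs s),
      ~ colinear fs ->
        (potentially_identical fs <->
         (forall s : 'S_n, is_minimum fs s <-> counterclockwise fs s)) &
      ~ colinear fs -> ~ potentially_identical fs ->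
        forall s : 'S_n, is_minimum fs s <-> (counterclockwise fs s /\ arc_condition fs s)].
Proof.
have hm (s : 'S_n) : wincr (core (word fs s)).
  by move=> f; rewrite mem_filter => /andP[_ /mapP[i _ ->]].
have hl (s : 'S_n) : lid \notin core (word fs s) by apply: lid_notin_core.
have hp := core_word_perm fs.
have ncol (s : 'S_n) : ~ colinear fs -> ~ colin (core (word fs s)).
  by move=> hc h; apply/hc/(colinearE fs s).
have min_ccw (s : 'S_n) : ~ colinear fs -> is_minimum fs s -> ccw (core (word fs s)).
  move=> hc /is_minimumE/(optimal_turning (hm s)); apply: turning_ccw => //; exact: ncol.
split.
- split=> [hc s|h].
    apply/is_minimumE => v hv; rewrite (colin_wcomp_perm _ _ hv) //.
      exact: wincr_perm hv (hm s).
    by move=> f g; rewrite !(perm_mem hv); exact: (iffLR (colinearE fs s) hc).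
  apply/(colinearE fs 1%g)/optimal_all_colin => // v hv.
  by have [r ->] := core_surj hv; apply/is_minimumE.
- move=> hc; split.
    case=> s0 [/counterclockwiseE c0 /identicalE]; rewrite fsigE => i0 s.
    have idc (r : 'S_n) : ccw (core (word fs r)) -> wcomp (core (word fs r)) = lid.
      by move=> cr; apply: (ccw_lid (hm s0) (hl s0) (hp s0 r) c0 cr i0).
    split=> [/(min_ccw s hc)|/counterclockwiseE cs]; first by move/counterclockwiseE.
    (* A minimum [m] is counterclockwise too, and all counterclockwise orders compose to [lid]. *)
    have [m hmin] := minimum_exists fs.
    apply/is_minimumE; apply: (optimal_perm (hp s m)); last by apply/is_minimumE.
    by rewrite !idc //; apply: min_ccw.
  (* Rotations of the minimum [m] are counterclockwise, hence minimum by [h]; a composition other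
     than [lid] would then force colinearity. *)
  move=> h; have [m hmin] := minimum_exists fs; exists m; split; first exact/h.
  apply/identicalE; rewrite fsigE; apply: contrapT => V0; apply: hc.
  apply/(colinearE fs m); apply: (rotations_optimal_colin V0) => u v e.
  have [r er] : exists r : 'S_n, v ++ u = core (word fs r).
    by apply: (core_surj (s := m)); rewrite e perm_catC.
  rewrite er; apply/is_minimumE/h/counterclockwiseE; rewrite -er.
  by apply: ccw_rot; rewrite -e; apply/counterclockwiseE/h.
- move=> hc hpi s.
  have hcol (r : 'S_n) : ~ colin (core (word fs r)) by apply: ncol.
  have nonnil (r : 'S_n) : core (word fs r) <> [::].
    by move=> e; apply: (hcol r); rewrite e.
  have nonid (r : 'S_n) : ccw (core (word fs r)) -> wcomp (core (word fs r)) != lid.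
    move=> cr; apply/eqP => e; apply: hpi; exists r; split.
      exact/counterclockwiseE.
    by apply/identicalE; rewrite fsigE.
  have min_convex (r : 'S_n) : is_minimum fs r ->
      exists2 c, antipode (wcomp (core (word fs r))) c & convex_at c (core (word fs r)).
    move=> hr; have [c pc] := antipode_exists (nonid r (min_ccw r hc hr)).
    exists c => //; apply: turning_convex => //.
    by apply: optimal_turning => //; apply/is_minimumE.
  have arcE (r : 'S_n) c : antipode (wcomp (core (word fs r))) c ->
      convex_at c (core (word fs r)) <-> counterclockwise fs r /\ arc_condition fs r.
    move=> [/eqP V0 c2pi ec].
    rewrite (convex_in_arc (hl r) (hcol r) c2pi ec) counterclockwiseE.
    by rewrite (arc_conditionE (nonnil r)); split=> [[? ?]|[? [_ ?]]].
  split=> [/min_convex[c pc]|hs]; first by move/(arcE _ _ pc).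
  have [c pc] : exists c, antipode (wcomp (core (word fs s))) c.
    by apply/antipode_exists/nonid/counterclockwiseE; case: hs.
  (* Both [s] and the minimum [m] are convex, so they have the same composition. *)
  have [m hmin] := minimum_exists fs; have [d pd cd] := min_convex m hmin.
  apply/is_minimumE; apply: (optimal_perm (hp s m)); last by apply/is_minimumE.
  congr beta; apply: (convex_wcomp_eq (hp s m) (hm s) (hl s) pc pd _ cd).
  exact/(arcE _ _ pc).
Qed.
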